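(* Let $k\geq 1$. Let $B_k$ be the braid group given by the presentation $$B_k=\left\langle \sigma_1,\ldots,\sigma_{k-1}\ \middle|\ \sigma_i\sigma_{i+1}\sigma_i=\sigma_{i+1}\sigma_i\sigma_{i+1},\ \ \sigma_i\sigma_j=\sigma_j\sigma_i\ \text{ if } |i-j|>1\right\rangle.$$ The canonical homomorphism $B_k\to \pi_1(B_k(\mathbb{R}^2))$, which sends the generator $\sigma_i$ to the homotopy class of the explicit half-twist loop exchanging the $i$th and $(i+1)$st points (described in the context), is an isomorphism of groups.
   Context: $\mathrm{Conf}_k(\mathbb{R}^2)=\{(x_1,\ldots,x_k)\in(\mathbb{R}^2)^k: x_i\neq x_j \text{ if } i\neq j\}$ with the subspace topology, and $B_k(\mathbb{R}^2)=\mathrm{Conf}_k(\mathbb{R}^2)/\Sigma_k$ is the quotient by the action of the symmetric group permuting coordinates. The base point of $B_k(\mathbb{R}^2)$ is $\{(2,0),(4,0),\ldots,(2k,0)\}$. For $a,b\in\mathbb{R}$, put $c_{a,b}(t)=(a+b\cos t,\, b\sin t)$. For $1\leq i\leq k-1$ define $p_i:[0,\pi]\to(\mathbb{R}^2)^k$ by $p_i(t)_r=(2r,0)$ if $r\notin\{i,i+1\}$, $p_i(t)_i=c_{2i+1,1}(t+\pi)$, and $p_i(t)_{i+1}=c_{2i+1,1}(t)$. This path lies in $\mathrm{Conf}_k(\mathbb{R}^2)$, and its image in $B_k(\mathbb{R}^2)$ is a loop at the base point; the homotopy class of this loop is the element of $\pi_1(B_k(\mathbb{R}^2))$ assigned to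 the generator $\sigma_i$. These elements satisfy the defining relations of $B_k$, so the assignment defines a group homomorphism. *)

(* Defs.v *)
From HB Require Import structures.
From mathcomp Require Import all_boot all_order all_algebra perm.
From mathcomp Require Import all_classical all_reals.
From mathcomp Require Import topology normedtype trigo homotopy ring lra.

Set Implicit Arguments.
Unset Strict Implicit.
Unset Printing Implicit Defensive.

Import Order.TTheory GRing.Theory Num.Theory.
Import numFieldNormedType.Exports.

Local Open Scope classical_set_scope.
Local Open Scope ring_scope.
Local Open Scope quotient_scope.

(** * Groups given by generators and relations *)

(* The letter [(a, false)] stands for the generator [a], and [(a, true)] for
   its formal inverse. *)
Definition word (A : choiceType) : Type := seq (A * bool).

Definition inv_word (A : choiceType) (w : word A) : word A :=
  rev [seq (l.1, ~~ l.2) | l <- w].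

Inductive word_eq (A : choiceType) (rels : word A -> word A -> Prop) :
    word A -> word A -> Prop :=
| word_eq_rel u v : rels u v -> word_eq rels u v
| word_eq_cancel a b : word_eq rels [:: (a, b); (a, ~~ b)] [::]
| word_eq_refl u : word_eq rels u u
| word_eq_sym u v : word_eq rels u v -> word_eq rels v u
| word_eq_trans v u w : word_eq rels u v -> word_eq rels v w -> word_eq rels u w
| word_eq_cat u u' v v' :
    word_eq rels u u' -> word_eq rels v v' -> word_eq rels (u ++ v) (u' ++ v').

Section presented_group.
Context (A : choiceType) (rels : word A -> word A -> Prop).

Definition word_eqb : rel (word A) := fun u v => `[< word_eq rels u v >].

Lemma word_eqb_refl : reflexive word_eqb.
Proof. by move=> u; apply/asboolP; exact: word_eq_refl. Qed.

Lemma word_eqb_sym : symmetric word_eqb.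
Proof.
by move=> u v; apply/asboolP/asboolP => uv; exact: word_eq_sym.
Qed.

Lemma word_eqb_trans : transitive word_eqb.
Proof.
move=> v u w /asboolP uv /asboolP vw; apply/asboolP.
exact: word_eq_trans uv vw.
Qed.

Canonical word_equiv :=
  EquivRel word_eqb word_eqb_refl word_eqb_sym word_eqb_trans.

Definition presented_group : Type := {eq_quot word_equiv}.

HB.instance Definition _ := Choice.on presented_group.
HB.instance Definition _ := Quotient.on presented_group.

Implicit Types (u v w : word A) (x y z : presented_group).

Definition pg_pi u : presented_group := \pi_presented_group u.

Definition pg_gen (a : A) : presented_group := pg_pi [:: (a, false)].

Definition pg_one : presented_group := pg_pi [::].
Definition pg_inv x : presented_group := pg_pi (inv_word (repr x)).
Definition pg_mul x y : presented_group := pg_pi (repr x ++ repr y).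

Lemma pg_piP u v : pg_pi u = pg_pi v <-> word_eq rels u v.
Proof.
by split=> [/eqmodP/asboolP//|uv]; apply/eqmodP/asboolP.
Qed.

Lemma pg_piK x : pg_pi (repr x) = x. Proof. exact: reprK. Qed.

Lemma pg_repr_pi u : word_eq rels (repr (pg_pi u)) u.
Proof. by apply/pg_piP; rewrite pg_piK. Qed.

Lemma pg_mul_pi u v : pg_mul (pg_pi u) (pg_pi v) = pg_pi (u ++ v).
Proof. by apply/pg_piP; apply: word_eq_cat; exact: pg_repr_pi. Qed.

Lemma inv_word_cons l w : inv_word (l :: w) = inv_word w ++ [:: (l.1, ~~ l.2)].
Proof. by rewrite /inv_word /= rev_cons cats1. Qed.

Lemma word_eq_invr w : word_eq rels (w ++ inv_word w) [::].
Proof.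
elim: w => [|[a b] w IH]; first exact: word_eq_refl.
rewrite inv_word_cons -cat1s -catA (catA w).
apply: (@word_eq_trans _ _ ([:: (a, b)] ++ [::] ++ [:: (a, ~~ b)])).
  apply: word_eq_cat; first exact: word_eq_refl.
  by apply: word_eq_cat IH _; exact: word_eq_refl.
exact: word_eq_cancel.
Qed.

Lemma inv_wordK : involutive (@inv_word A).
Proof.
move=> w; rewrite /inv_word map_rev revK -map_comp -[RHS]map_id.
by apply: eq_map => -[a b] /=; rewrite negbK.
Qed.

Lemma word_eq_invl w : word_eq rels (inv_word w ++ w) [::].
Proof. by rewrite -{2}[w]inv_wordK; exact: word_eq_invr. Qed.

Lemma pg_mulA : associative pg_mul.
Proof.
move=> x y z; rewrite -(pg_piK x) -(pg_piK y) -(pg_piK z).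
by rewrite !pg_mul_pi catA.
Qed.

Lemma pg_mul1g : left_id pg_one pg_mul.
Proof. by move=> x; rewrite -(pg_piK x) pg_mul_pi. Qed.

Lemma pg_mulg1 : right_id pg_one pg_mul.
Proof. by move=> x; rewrite -(pg_piK x) pg_mul_pi cats0. Qed.

Lemma pg_mulVg : left_inverse pg_one pg_inv pg_mul.
Proof.
move=> x; rewrite -{2}(pg_piK x) pg_mul_pi.
by apply/pg_piP; exact: word_eq_invl.
Qed.

Lemma pg_mulgV : right_inverse pg_one pg_inv pg_mul.
Proof.
move=> x; rewrite -{1}(pg_piK x) pg_mul_pi.
by apply/pg_piP; exact: word_eq_invr.
Qed.

HB.instance Definition _ := isGroup.Build presented_group
  pg_mulA pg_mul1g pg_mulg1 pg_mulVg pg_mulgV.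

Lemma pg_mulE u v : (pg_pi u * pg_pi v)%g = pg_pi (u ++ v).
Proof. exact: pg_mul_pi. Qed.

Lemma pg_genV a : ((pg_gen a)^-1)%g = pg_pi [:: (a, true)].
Proof.
apply/esym/(mulgI (pg_gen a)); rewrite mulgV pg_mulE.
by apply/pg_piP; exact: (word_eq_cancel _ a false).
Qed.

(* A homomorphism is determined by its values on the generators. *)
Lemma presented_group_hom_ext (G : groupType)
    (f g : {multiplicative presented_group -> G}) :
  (forall a, f (pg_gen a) = g (pg_gen a)) -> f =1 g.
Proof.
have f1 (h : {multiplicative presented_group -> G}) : h 1%g = 1%g.
  by apply: (mulgI (h 1%g)); rewrite -gmulfM !mulg1.
have fV (h : {multiplicative presented_group -> G}) x :
    h (x^-1)%g = ((h x)^-1)%g.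
  by apply: (mulgI (h x)); rewrite -gmulfM !mulgV f1.
move=> fg x; rewrite -(pg_piK x); elim: (repr x) => [|[a b] w IH].
  by rewrite (_ : pg_pi [::] = 1%g) // !f1.
rewrite -cat1s -pg_mulE !gmulfM IH; congr (_ * _)%g.
by case: b; [rewrite -pg_genV !fV fg|exact: fg].
Qed.

End presented_group.

(** * Braid groups *)

(* The generators are numbered from [0]: the index [i : 'I_k.-1] stands for
   the usual generator of index [i + 1]. *)
Inductive braid_rel (k : nat) : word 'I_k.-1 -> word 'I_k.-1 -> Prop :=
| braid_rel_braid (i j : 'I_k.-1) : j = i.+1 :> nat ->
    braid_rel [:: (i, false); (j, false); (i, false)]
              [:: (j, false); (i, false); (j, false)]
| braid_rel_comm (i j : 'I_k.-1) : 1 < `|(i : nat)%:Z - (j : nat)%:Z| ->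
    braid_rel [:: (i, false); (j, false)] [:: (j, false); (i, false)].

Definition braid_group (k : nat) : Type := presented_group (@braid_rel k).

HB.instance Definition _ (k : nat) := Group.on (braid_group k).

Definition braid_gen (k : nat) (i : 'I_k.-1) : braid_group k :=
  pg_gen (@braid_rel k) i.

(** * The unit interval *)

Definition unit_interval (R : realType) : Type :=
  set_type `[0%R : R, 1%R]%classic.

HB.instance Definition _ (R : realType) := Topological.on (unit_interval R).

Section unit_interval.
Context (R : realType).
Local Notation I := (unit_interval R).

Lemma clampI_subproof (x : R) :
  Num.max 0 (Num.min 1 x) \in `[0%R : R, 1%R]%classic.
Proof.
rewrite inE /= in_itv /= le_max lexx /= ge_max ler01 /=.
by rewrite ge_min lexx.
Qed.

Definition clampI (x : R) : I :=
  exist (fun y => y \in `[0%R : R, 1%R]%classic) _ (clampI_subproof x).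
Definition valI (t : I) : R := \val t.

Lemma valI_ge0 t : 0 <= valI t.
Proof. by have := valP t; rewrite inE /= in_itv /= => /andP[]. Qed.

Lemma valI_le1 t : valI t <= 1.
Proof. by have := valP t; rewrite inE /= in_itv /= => /andP[]. Qed.

Lemma clampIE x : 0 <= x -> x <= 1 -> valI (clampI x) = x.
Proof. by move=> x0 x1; rewrite /valI /=; rewrite min_r // max_r. Qed.

Lemma valI_inj : injective valI. Proof. exact: val_inj. Qed.

Lemma valIK : cancel valI clampI.
Proof.
by move=> t; apply: valI_inj; rewrite clampIE ?valI_ge0 ?valI_le1.
Qed.

Lemma zeroI_neq_oneI : clampI 0 != clampI 1.
Proof.
apply/eqP => /(congr1 valI); rewrite !clampIE ?ler01 ?lexx //.
by move/eqP; rewrite eq_sym oner_eq0.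
Qed.

HB.instance Definition _ := @isBiPointed.Build I (clampI 0) (clampI 1)
  zeroI_neq_oneI.

Lemma continuous_valI : continuous valI.
Proof. exact: initial_continuous. Qed.

Lemma continuous_clampI : continuous clampI.
Proof.
apply: continuous_comp_initial => x.
apply: (@continuous_max R R (fun=> 0) (fun x => Num.min 1 x)).
  apply: cvg_cst.
apply: (@continuous_min R R (fun=> 1) id); first apply: cvg_cst.
exact: cvg_id.
Qed.

End unit_interval.

(** * Fundamental groups *)

Lemma continuous_compT (X Y Z : topologicalType) (f : X -> Y) (g : Y -> Z) :
  continuous f -> continuous g -> continuous (fun x => g (f x)).
Proof. by move=> cf cg x; apply: continuous_comp; [exact: cf|exact: cg]. Qed.

Lemma continuous_idT (X : topologicalType) : continuous (fun x : X => x).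
Proof. by move=> x; exact: cvg_id. Qed.

Lemma continuous_pairT (X Y Z : topologicalType) (f : X -> Y) (g : X -> Z) :
  continuous f -> continuous g -> continuous (fun x => (f x, g x)).
Proof.
move=> cf cg x; rewrite /continuous_at.
by apply: cvg_pair; [exact: cf|exact: cg].
Qed.

Lemma continuous_fstT (X Y : topologicalType) : continuous (@fst X Y).
Proof. by move=> ?; exact: cvg_fst. Qed.

Lemma continuous_sndT (X Y : topologicalType) : continuous (@snd X Y).
Proof. by move=> ?; exact: cvg_snd. Qed.

Lemma continuous_onesub (R : realType) : continuous (fun x : R => 1 - x).
Proof. by move=> x; apply: cvgB; [apply: cvg_cst|exact: cvg_id]. Qed.

Lemma continuous_pasting (R : realType) (S X : topologicalType)
    (u : S -> R) (c : R) (f g : S -> X) :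
  continuous u -> continuous f -> continuous g ->
  (forall s, u s = c -> f s = g s) ->
  continuous (fun s => if u s <= c then f s else g s).
Proof.
move=> cu cf cg fg s W /= sW.
have nf : nbhs (f s) W -> nbhs s (f @^-1` W) by exact: cf.
have ng : nbhs (g s) W -> nbhs s (g @^-1` W) by exact: cg.
change (nbhs s [set y | W (if u y <= c then f y else g y)]).
have [us|us|us] := ltgtP (u s) c.
- move: sW; rewrite ltW // => /nf {}nf.
  have nu : nbhs s (u @^-1` [set y | y < c]).
    by apply: (cu s); exact: open_nbhs_nbhs (conj (@open_lt _ _) us).
  by apply: filterS2 nf nu => y /= fy cy; rewrite ltW.
- move: sW; rewrite leNgt us /= => /ng {}ng.
  have nu : nbhs s (u @^-1` [set y | c < y]).
    by apply: (cu s); exact: open_nbhs_nbhs (conj (@open_gt _ _) us).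
  by apply: filterS2 ng nu => y /= gy cy; rewrite leNgt cy.
- move: sW; rewrite us lexx => sW.
  have {}ng : nbhs s (g @^-1` W) by apply: ng; rewrite -fg.
  by apply: filterS2 (nf sW) ng => y /= fy gy; case: ifP.
Qed.

Section fundamental_group.
Context (R : realType) (X : topologicalType) (x0 : X).
Local Notation I := (unit_interval R).

Definition loop : Type := {path I from x0 to x0 in X}.

HB.instance Definition _ := Choice.on loop.

Implicit Types (p q r : loop).

(* Homotopy relative to the endpoints. *)
Definition loop_homotopic p q : Prop :=
  exists H : I * I -> X,
    [/\ continuous H,
        forall t, H (t, zero) = p t,
        forall t, H (t, one) = q t,
        forall s, H (zero, s) = x0
      & forall s, H (one, s) = x0].

Let valI0 : valI (zero : I) = 0.
Proof. by rewrite clampIE ?lexx ?ler01. Qed.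

Let valI1 : valI (one : I) = 1.
Proof. by rewrite clampIE ?lexx ?ler01. Qed.

Let clampI_eq0 (x : R) : x = 0 -> clampI x = (zero : I).
Proof. by move->. Qed.

Let clampI_eq1 (x : R) : x = 1 -> clampI x = (one : I).
Proof. by move->. Qed.

Let loop_cts p : continuous p. Proof. exact: cts_fun. Qed.

Let loop0 p : p zero = x0. Proof. exact: path_zero. Qed.
Let loop1 p : p one = x0. Proof. exact: path_one. Qed.

Lemma loop_homotopic_reparam p (phi psi : I -> I) q r :
  continuous phi -> continuous psi ->
  phi zero = psi zero -> phi one = psi one ->
  (forall t, q t = p (phi t)) -> (forall t, r t = p (psi t)) ->
  loop_homotopic q r.
Proof.
move=> cphi cpsi e0 e1 qE rE.
exists (fun z => p (clampI ((1 - valI z.2) * valI (phi z.1)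
                            + valI z.2 * valI (psi z.1)))); split=> [|t|t|s|s].
- apply: (continuous_compT (g := p)); last exact: loop_cts.
  apply: (continuous_compT (g := @clampI R)); last exact: continuous_clampI.
  have c2 : continuous (fun z : I * I => valI z.2).
    apply: (continuous_compT (g := @valI R)); last exact: continuous_valI.
    exact: continuous_sndT.
  have c1 (f : I -> I) : continuous f ->
      continuous (fun z : I * I => valI (f z.1)).
    move=> cf; apply: (continuous_compT (g := @valI R)).
      by apply: (continuous_compT (g := f)) => // ?; exact: cvg_fst.
    exact: continuous_valI.
  move=> z; apply: cvgD; apply: cvgM; [apply: cvgB| | |].
  + apply: cvg_cst.
  + exact: c2.
  + exact: (c1 phi).
  + exact: c2.
  + exact: (c1 psi).
- by rewrite /= valI0 subr0 mul1r mul0r addr0 valIK qE.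
- by rewrite /= valI1 subrr mul1r mul0r add0r valIK rE.
- by rewrite /= e0 -mulrDl subrK mul1r valIK -rE loop0.
- by rewrite /= e1 -mulrDl subrK mul1r valIK -rE loop1.
Qed.

Lemma loop_homotopic_ext p q : p =1 q -> loop_homotopic p q.
Proof.
move=> pq; apply: (@loop_homotopic_reparam q id id) => //;
  exact: continuous_idT.
Qed.

Lemma loop_homotopic_sym p q : loop_homotopic p q -> loop_homotopic q p.
Proof.
case=> H [cH H0 H1 Hl Hr].
exists (fun z => H (z.1, clampI (1 - valI z.2))); split=> [|t|t|s|s] //=.
- have cf : continuous (fun z : I * I => clampI (1 - valI z.2)).
    apply: (continuous_compT (f := snd) (g := fun t => clampI (1 - valI t))).
      exact: continuous_sndT.
    apply: (continuous_compT (g := @clampI R)); last exact: continuous_clampI.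
    apply: (continuous_compT (f := @valI R) (g := fun x => 1 - x)).
      exact: continuous_valI.
    exact: continuous_onesub.
  apply: (continuous_compT (g := H)) => //.
  by apply: continuous_pairT; [exact: continuous_fstT|exact: cf].
- by rewrite valI0 subr0 H1.
- by rewrite valI1 subrr H0.
Qed.

Let continuous_fst_snd (Y : topologicalType) (H : I * Y -> X) (f : R -> R) :
  continuous f -> continuous H ->
  continuous (fun z : I * Y => H (clampI (f (valI z.1)), z.2)).
Proof.
move=> cf cH; have cf' : continuous (fun z : I * Y => clampI (f (valI z.1))).
  apply: (continuous_compT (f := fst) (g := fun t => clampI (f (valI t)))).
    exact: continuous_fstT.
  apply: (continuous_compT (g := @clampI R)); last exact: continuous_clampI.
  apply: (continuous_compT (f := @valI R) (g := f)) => //.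
  exact: continuous_valI.
apply: (continuous_compT (g := H)) => //.
by apply: continuous_pairT; [exact: cf'|exact: continuous_sndT].
Qed.

Let continuous_double : continuous (fun x : R => 2 * x).
Proof. by move=> x; apply: cvgM; [apply: cvg_cst|exact: cvg_id]. Qed.

Let continuous_double_sub1 : continuous (fun x : R => 2 * x - 1).
Proof.
by move=> x; apply: cvgB; [exact: continuous_double|apply: cvg_cst].
Qed.

(* Concatenation in the first coordinate, with a parameter [y]. *)
Let glue (Y : Type) (H K : I * Y -> X) (z : I * Y) : X :=
  if valI z.1 <= 1 / 2 then H (clampI (2 * valI z.1), z.2)
  else K (clampI (2 * valI z.1 - 1), z.2).

Let continuous_glue (Y : topologicalType) (H K : I * Y -> X) :
  continuous H -> continuous K ->
  (forall y, H (one, y) = K (zero, y)) -> continuous (glue H K).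
Proof.
move=> cH cK HK; apply: continuous_pasting.
- apply: (continuous_compT (g := @valI R)); last exact: continuous_valI.
  exact: continuous_fstT.
- exact: continuous_fst_snd continuous_double cH.
- exact: continuous_fst_snd continuous_double_sub1 cK.
- move=> z ->; have -> : 2 * (1 / 2) = 1 :> R by field.
  by rewrite subrr HK.
Qed.

Let glue0 Y (H K : I * Y -> X) y : glue H K (zero, y) = H (zero, y).
Proof. by rewrite /glue /= valI0 ifT ?mulr0 //; lra. Qed.

Let glue1 Y (H K : I * Y -> X) y : glue H K (one, y) = K (one, y).
Proof.
rewrite /glue /= valI1 ifF; last by apply/negbTE; rewrite -ltNge; lra.
by congr (K (clampI _, _)); lra.
Qed.

Lemma loop_homotopic_trans q p r :
  loop_homotopic p q -> loop_homotopic q r -> loop_homotopic p r.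
Proof.
move=> [H [cH H0 H1 Hl Hr]] [K [cK K0 K1 Kl Kr]].
pose sw (F : I * I -> X) z := F (z.2, z.1).
have csw (F : I * I -> X) : continuous F -> continuous (sw F).
  move=> cF; apply: (continuous_compT (g := F)) => //.
  by apply: continuous_pairT; [exact: continuous_sndT|exact: continuous_fstT].
exists (sw (glue (sw H) (sw K))); split=> [|t|t|s|s].
- apply/csw/continuous_glue; [exact: csw|exact: csw|move=> y].
  by rewrite /sw /= H1 K0.
- by rewrite /sw glue0 /= H0.
- by rewrite /sw glue1 /= K1.
- by rewrite /sw /glue /=; case: ifP; rewrite ?Hl ?Kl.
- by rewrite /sw /glue /=; case: ifP; rewrite ?Hr ?Kr.
Qed.

(* The first loop is followed first. *)
Definition loop_mul_fun p q (t : I) : X :=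
  if valI t <= 1 / 2 then p (clampI (2 * valI t))
  else q (clampI (2 * valI t - 1)).

Let loop_mul_funE p q t :
  loop_mul_fun p q t = glue (fun z => p z.1) (fun z => q z.1) (t, tt).
Proof. by []. Qed.

Lemma loop_mul_cts p q : continuous (loop_mul_fun p q).
Proof.
apply: (@continuous_pasting R).
- exact: continuous_valI.
- apply: (continuous_compT (g := p)); last exact: loop_cts.
  apply: (continuous_compT (g := @clampI R)); last exact: continuous_clampI.
  apply: (continuous_compT (f := @valI R) (g := fun x => 2 * x)) => //.
  exact: continuous_valI.
- apply: (continuous_compT (g := q)); last exact: loop_cts.
  apply: (continuous_compT (g := @clampI R)); last exact: continuous_clampI.
  apply: (continuous_compT (f := @valI R) (g := fun x => 2 * x - 1)) => //.
  exact: continuous_valI.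
- move=> t ->; have -> : 2 * (1 / 2) = 1 :> R by field.
  by rewrite subrr loop0 loop1.
Qed.

Lemma loop_mul_zero p q : loop_mul_fun p q zero = x0.
Proof. by rewrite loop_mul_funE glue0 loop0. Qed.

Lemma loop_mul_one p q : loop_mul_fun p q one = x0.
Proof. by rewrite loop_mul_funE glue1 loop1. Qed.

Definition loop_mul p q : loop :=
  mk_path (@loop_mul_cts p q) (loop_mul_zero p q) (loop_mul_one p q).

Definition loop_one : loop := cst x0.

Let continuous_rev : continuous (fun t : I => clampI (1 - valI t)).
Proof.
apply: (continuous_compT (g := @clampI R)); last exact: continuous_clampI.
apply: (continuous_compT (f := @valI R) (g := fun x => 1 - x)).
  exact: continuous_valI.
exact: continuous_onesub.
Qed.

Lemma loop_inv_cts p : continuous (fun t : I => p (clampI (1 - valI t))).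
Proof.
exact: (continuous_compT (g := p) continuous_rev (@loop_cts p)).
Qed.

Lemma loop_inv_zero p : p (clampI (1 - valI (zero : I))) = x0.
Proof. by rewrite valI0 subr0 loop1. Qed.

Lemma loop_inv_one p : p (clampI (1 - valI (one : I))) = x0.
Proof. by rewrite valI1 subrr loop0. Qed.

Definition loop_inv p : loop :=
  mk_path (@loop_inv_cts p) (loop_inv_zero p) (loop_inv_one p).

Lemma loop_mulE p q t : loop_mul p q t =
  if valI t <= 1 / 2 then p (clampI (2 * valI t))
  else q (clampI (2 * valI t - 1)).
Proof. by []. Qed.

Lemma loop_oneE t : loop_one t = x0.
Proof. by []. Qed.

Lemma loop_invE p t : loop_inv p t = p (clampI (1 - valI t)).
Proof. by []. Qed.

Lemma loop_homotopic_mul p p' q q' :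
  loop_homotopic p p' -> loop_homotopic q q' ->
  loop_homotopic (loop_mul p q) (loop_mul p' q').
Proof.
move=> [H [cH H0 H1 Hl Hr]] [K [cK K0 K1 Kl Kr]].
exists (glue H K); split=> [|t|t|s|s].
- by apply: continuous_glue => // y; rewrite Hr Kl.
- by rewrite /glue /= H0 K0.
- by rewrite /glue /= H1 K1.
- by rewrite glue0.
- by rewrite glue1.
Qed.

Lemma loop_homotopic_inv p p' :
  loop_homotopic p p' -> loop_homotopic (loop_inv p) (loop_inv p').
Proof.
move=> [H [cH H0 H1 Hl Hr]].
exists (fun z => H (clampI (1 - valI z.1), z.2)); split=> [|t|t|s|s] //=.
- apply: (@continuous_fst_snd I H (fun x => 1 - x)) => //.
  exact: continuous_onesub.
- by rewrite valI0 subr0 Hr.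
- by rewrite valI1 subrr Hl.
Qed.

(* A piecewise-linear change of parameter, in two pieces. *)
Let continuous_if (f g : R -> R) (c : R) :
  continuous f -> continuous g -> f c = g c ->
  continuous (fun t : I =>
    clampI (if valI t <= c then f (valI t) else g (valI t))).
Proof.
move=> cf cg fg; apply: (continuous_compT (g := @clampI R)).
  apply: continuous_pasting.
  - exact: continuous_valI.
  - apply: (continuous_compT (f := @valI R) (g := f)) => //.
    exact: continuous_valI.
  - apply: (continuous_compT (f := @valI R) (g := g)) => //.
    exact: continuous_valI.
  - by move=> t ->.
exact: continuous_clampI.
Qed.

Let continuous_affine (a b : R) : continuous (fun x : R => a * x + b).
Proof.
by move=> x; apply: cvgD; [apply: cvgM; [apply: cvg_cst|exact: cvg_id]
                          |apply: cvg_cst].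
Qed.

Let continuous_if_affine (a b a' b' c : R) : a * c + b = a' * c + b' ->
  continuous (fun t : I =>
    clampI (if valI t <= c then a * valI t + b else a' * valI t + b')).
Proof.
move=> abc; apply: (@continuous_if (fun x => a * x + b) (fun x => a' * x + b')).
- exact: continuous_affine.
- exact: continuous_affine.
- exact: abc.
Qed.

Lemma loop_mul1g p : loop_homotopic (loop_mul loop_one p) p.
Proof.
apply: (@loop_homotopic_reparam p
  (fun t => clampI (if valI t <= 1 / 2 then 0 * valI t + 0
                    else 2 * valI t + -1)) id).
- by apply: continuous_if_affine; lra.
- exact: continuous_idT.
- by rewrite valI0 ifT; [apply: clampI_eq0; lra|lra].
- rewrite valI1 ifF; last by apply/negbTE; rewrite -ltNge; lra.
  by apply: clampI_eq1; lra.
- move=> t; rewrite loop_mulE ?loop_oneE ?loop_invE; case: ifP => // _.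
  by rewrite mul0r addr0 loop0.
- by [].
Qed.

Lemma loop_mulg1 p : loop_homotopic (loop_mul p loop_one) p.
Proof.
apply: (@loop_homotopic_reparam p
  (fun t => clampI (if valI t <= 1 / 2 then 2 * valI t + 0
                    else 0 * valI t + 1)) id).
- by apply: continuous_if_affine; lra.
- exact: continuous_idT.
- by rewrite valI0 ifT; [apply: clampI_eq0; lra|lra].
- rewrite valI1 ifF; last by apply/negbTE; rewrite -ltNge; lra.
  by apply: clampI_eq1; lra.
- move=> t; rewrite loop_mulE ?loop_oneE ?loop_invE; case: ifP => // _.
    by rewrite addr0.
  by rewrite mul0r add0r loop1.
- by [].
Qed.

Lemma loop_mulgV p : loop_homotopic (loop_mul p (loop_inv p)) loop_one.
Proof.
apply: (@loop_homotopic_reparam p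
  (fun t => clampI (if valI t <= 1 / 2 then 2 * valI t + 0
                    else (- 2) * valI t + 2)) (fun=> zero)).
- by apply: continuous_if_affine; lra.
- exact: cst_continuous.
- by rewrite valI0 ifT; [apply: clampI_eq0; lra|lra].
- rewrite valI1 ifF; last by apply/negbTE; rewrite -ltNge; lra.
  by apply: clampI_eq0; lra.
- move=> t; rewrite loop_mulE ?loop_oneE ?loop_invE; case: ifPn => [_|].
    by rewrite addr0.
  rewrite -ltNge => t2; congr (p (clampI _)).
  by rewrite clampIE; have := valI_le1 t; lra.
- by move=> t; rewrite loop_oneE loop0.
Qed.

Lemma loop_mulVg p : loop_homotopic (loop_mul (loop_inv p) p) loop_one.
Proof.
apply: (@loop_homotopic_reparam p
  (fun t => clampI (if valI t <= 1 / 2 then (- 2) * valI t + 1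
                    else 2 * valI t + -1)) (fun=> one)).
- by apply: continuous_if_affine; lra.
- exact: cst_continuous.
- by rewrite valI0 ifT; [apply: clampI_eq1; lra|lra].
- rewrite valI1 ifF; last by apply/negbTE; rewrite -ltNge; lra.
  by apply: clampI_eq1; lra.
- move=> t; rewrite loop_mulE ?loop_oneE ?loop_invE; case: ifPn => [t2|//].
  congr (p (clampI _)).
  by rewrite clampIE; have := valI_ge0 t; lra.
- by move=> t; rewrite loop_oneE loop1.
Qed.

Lemma loop_mulA p q r :
  loop_homotopic (loop_mul p (loop_mul q r)) (loop_mul (loop_mul p q) r).
Proof.
apply: (@loop_homotopic_reparam (loop_mul (loop_mul p q) r)
  (fun t => clampI (if valI t <= 3 / 4 then
                      (if valI t <= 1 / 2 then 1 / 2 * valI t + 0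
                       else 1 * valI t + (- (1 / 4)))
                    else 2 * valI t + (- 1))) id).
- apply: (@continuous_if (fun x => if x <= 1 / 2 then 1 / 2 * x + 0
                                   else 1 * x + (- (1 / 4)))
                        (fun x => 2 * x + (- 1))).
  + apply: (@continuous_pasting R R R id (1 / 2)
             (fun x => 1 / 2 * x + 0) (fun x => 1 * x + (- (1 / 4)))).
    * exact: continuous_idT.
    * exact: continuous_affine.
    * exact: continuous_affine.
    * by move=> x ->; lra.
  + exact: continuous_affine.
  + by rewrite ifF; [lra|apply/negbTE; rewrite -ltNge; lra].
- exact: continuous_idT.
- by rewrite valI0 !ifT; [apply: clampI_eq0; lra|lra|lra].
- rewrite valI1 ifF; last by apply/negbTE; rewrite -ltNge; lra.
  by apply: clampI_eq1; lra.
- move=> t; have := valI_ge0 t; have := valI_le1 t.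
  set x := valI t => x1 x0'; rewrite (loop_mulE p (loop_mul q r)) -/x.
  have gtF (a b : R) : b < a -> (a <= b) = false.
    by move=> ab; rewrite leNgt ab.
  have [h1|h1] := leP x (1 / 2).
    rewrite (_ : (if _ then _ else _) = x / 2); last by rewrite ifT; lra.
    rewrite loop_mulE clampIE; [|lra..].
    rewrite ifT; last lra.
    rewrite loop_mulE clampIE; [|lra..].
    rewrite ifT; last lra.
    by congr (p (clampI _)); lra.
  rewrite loop_mulE clampIE; [|lra..].
  have [h2|h2] := leP x (3 / 4).
    rewrite ifT; last lra.
    rewrite loop_mulE clampIE; [|lra..].
    rewrite ifT; last lra.
    rewrite loop_mulE clampIE; [|lra..].
    rewrite gtF; last lra.
    by congr (q (clampI _)); lra.
  rewrite gtF; last lra.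
  rewrite loop_mulE clampIE; [|lra..].
  rewrite gtF; last lra.
  by congr (r (clampI _)); lra.
- by [].
Qed.

Definition loop_homotopicb : rel loop := fun p q => `[< loop_homotopic p q >].

Lemma loop_homotopicb_refl : reflexive loop_homotopicb.
Proof. by move=> p; apply/asboolP; exact: loop_homotopic_ext. Qed.

Lemma loop_homotopicb_sym : symmetric loop_homotopicb.
Proof.
by move=> p q; apply/asboolP/asboolP => pq; exact: loop_homotopic_sym.
Qed.

Lemma loop_homotopicb_trans : transitive loop_homotopicb.
Proof.
move=> q p r /asboolP pq /asboolP qr; apply/asboolP.
exact: loop_homotopic_trans pq qr.
Qed.

Canonical loop_equiv := EquivRel loop_homotopicb
  loop_homotopicb_refl loop_homotopicb_sym loop_homotopicb_trans.

Definition fundamental_group : Type := {eq_quot loop_equiv}.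

HB.instance Definition _ := Choice.on fundamental_group.
HB.instance Definition _ := Quotient.on fundamental_group.

Implicit Types x y z : fundamental_group.

Definition loop_class p : fundamental_group := \pi_fundamental_group p.

Definition fg_one : fundamental_group := loop_class loop_one.
Definition fg_inv x : fundamental_group := loop_class (loop_inv (repr x)).
Definition fg_mul x y : fundamental_group :=
  loop_class (loop_mul (repr x) (repr y)).

Lemma loop_classP p q : loop_class p = loop_class q <-> loop_homotopic p q.
Proof. by split=> [/eqmodP/asboolP//|pq]; apply/eqmodP/asboolP. Qed.

Lemma loop_classK x : loop_class (repr x) = x. Proof. exact: reprK. Qed.

Let repr_loop_class p : loop_homotopic (repr (loop_class p)) p.
Proof. by apply/loop_classP; rewrite loop_classK. Qed.

Lemma loop_classM p q :
  fg_mul (loop_class p) (loop_class q) = loop_class (loop_mul p q).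
Proof.
by apply/loop_classP; apply: loop_homotopic_mul; exact: repr_loop_class.
Qed.

Lemma loop_classV p : fg_inv (loop_class p) = loop_class (loop_inv p).
Proof.
by apply/loop_classP; apply: loop_homotopic_inv; exact: repr_loop_class.
Qed.

Lemma fg_mulA : associative fg_mul.
Proof.
move=> x y z; rewrite -(loop_classK x) -(loop_classK y) -(loop_classK z).
by rewrite !loop_classM; apply/loop_classP; exact: loop_mulA.
Qed.

Lemma fg_mul1g : left_id fg_one fg_mul.
Proof.
move=> x; rewrite -(loop_classK x) loop_classM.
by apply/loop_classP; exact: loop_mul1g.
Qed.

Lemma fg_mulg1 : right_id fg_one fg_mul.
Proof.
move=> x; rewrite -(loop_classK x) loop_classM.
by apply/loop_classP; exact: loop_mulg1.
Qed.

Lemma fg_mulVg : left_inverse fg_one fg_inv fg_mul.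
Proof.
move=> x; rewrite -(loop_classK x) loop_classV loop_classM.
by apply/loop_classP; exact: loop_mulVg.
Qed.

Lemma fg_mulgV : right_inverse fg_one fg_inv fg_mul.
Proof.
move=> x; rewrite -(loop_classK x) loop_classV loop_classM.
by apply/loop_classP; exact: loop_mulgV.
Qed.

HB.instance Definition _ := isGroup.Build fundamental_group
  fg_mulA fg_mul1g fg_mulg1 fg_mulVg fg_mulgV.

End fundamental_group.

(** * Configuration spaces of the plane *)

Section configuration_spaces.
Context (R : realType) (k : nat).
Local Notation plane := (R * R)%type.

(* [set_type] carries the subspace topology, and [{ptws 'I_k -> plane}] is the
   product topology on the [k]-th power of the plane. *)
Definition ordered_conf : Type :=
  set_type [set x : {ptws 'I_k -> plane} | injective x].

HB.instance Definition _ := Topological.on ordered_conf.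

Definition conf_point (x : ordered_conf) (r : 'I_k) : plane := (\val x) r.

Definition same_orbit (x y : ordered_conf) : Prop :=
  exists s : 'S_k, forall r, conf_point y r = conf_point x (s r).

Definition same_orbitb : rel ordered_conf := fun x y => `[< same_orbit x y >].

Lemma same_orbitb_refl : reflexive same_orbitb.
Proof. by move=> x; apply/asboolP; exists 1%g => r; rewrite perm1. Qed.

Lemma same_orbitb_sym : symmetric same_orbitb.
Proof.
by move=> x y; apply/asboolP/asboolP => -[s sxy]; exists s^-1%g => r;
   rewrite sxy permKV.
Qed.

Lemma same_orbitb_trans : transitive same_orbitb.
Proof.
move=> y x z /asboolP[s sxy] /asboolP[u uyz]; apply/asboolP.
by exists (u * s)%g => r; rewrite uyz sxy permM.
Qed.

Canonical conf_equiv := EquivRel same_orbitb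
  same_orbitb_refl same_orbitb_sym same_orbitb_trans.

Definition unordered_conf : Type := quotient_topology {eq_quot conf_equiv}.

HB.instance Definition _ := Topological.on unordered_conf.
HB.instance Definition _ := Quotient.on unordered_conf.

Definition conf_pi (x : ordered_conf) : unordered_conf := \pi_unordered_conf x.

Lemma conf_piP x y : conf_pi x = conf_pi y <-> same_orbit x y.
Proof. by split=> [/eqmodP/asboolP//|xy]; apply/eqmodP/asboolP. Qed.

Lemma continuous_conf_pi : continuous conf_pi.
Proof. exact: pi_continuous. Qed.

Definition mk_conf (x : 'I_k -> plane) (xinj : injective x) : ordered_conf :=
  exist (fun y => y \in [set y : {ptws 'I_k -> plane} | injective y]) x
    (mem_set xinj).

(* Indices are numbered from [0], so that the point of index [r] stands for
   the point of index [r + 1] in the usual numbering. *)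
Definition base_points (r : 'I_k) : plane := (2 * r.+1%:R, 0).

Lemma base_points_inj : injective base_points.
Proof.
move=> r s /pair_equal_spec[/mulfI + _]; rewrite pnatr_eq0 => /(_ isT) /eqP.
by rewrite eqr_nat eqSS => /eqP /val_inj.
Qed.

Definition base_conf : unordered_conf := conf_pi (mk_conf base_points_inj).

(** * Half-twists *)

Definition circle_path (a b t : R) : plane := (a + b * cos t, b * sin t).

(* With [i] counted from [0], the centre [2 * i.+1 + 1] is the midpoint of the
   base points of indices [i] and [i.+1]. *)
Definition half_twist_points (i : 'I_k.-1) (t : R) (r : 'I_k) : plane :=
  if r == i :> nat then circle_path (2 * i.+1%:R + 1) 1 (t + pi)
  else if r == i.+1 :> nat then circle_path (2 * i.+1%:R + 1) 1 t
  else (2 * r.+1%:R, 0).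

Lemma circle_path_antipodal (a t : R) :
  circle_path a 1 (t + pi) <> circle_path a 1 t.
Proof.
rewrite /circle_path cosDpi sinDpi !mul1r => /pair_equal_spec[].
have := cos2Dsin2 t; move: (cos t) (sin t) => c s cs ac ss.
have c0 : c = 0 by lra.
have s0 : s = 0 by lra.
by move: cs => /eqP; rewrite c0 s0 !expr0n /= addr0 eq_sym oner_eq0.
Qed.

Lemma circle_path_far (i r : nat) (t : R) : r != i -> r != i.+1 ->
  circle_path (2 * i.+1%:R + 1) 1 t <> (2 * r.+1%:R, 0).
Proof.
move=> ri riS /pair_equal_spec[+ _]; rewrite mul1r => e.
have c1 := cos_le1 t; have cN1 := cos_geN1 t.
move: (cos t) e c1 cN1 => c e c1 cN1.
have [ltri|geri] := ltnP r i.
  have : r.+2%:R <= i.+1%:R :> R by rewrite ler_nat ltnS.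
  by rewrite -natr1; lra.
have : i.+3%:R <= r.+1%:R :> R.
  by rewrite ler_nat ltnS !ltn_neqAle geri eq_sym riS eq_sym ri.
by rewrite -natr1 -(natr1 i.+1); lra.
Qed.

Lemma half_twist_points_inj i t : injective (half_twist_points i t).
Proof.
move=> r s; rewrite /half_twist_points.
have [ri|ri] := eqVneq (r : nat) i; have [si|si] := eqVneq (s : nat) i.
- by move=> _; apply: val_inj; rewrite /= ri si.
- have [sS|sS] := eqVneq (s : nat) i.+1.
    by move/circle_path_antipodal.
  by move/(circle_path_far si sS).
- have [rS|rS] := eqVneq (r : nat) i.+1.
    by move/esym/circle_path_antipodal.
  by move/esym/(circle_path_far ri rS).
have [rS|rS] := eqVneq (r : nat) i.+1; have [sS|sS] := eqVneq (s : nat) i.+1.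
- by move=> _; apply: val_inj; rewrite /= rS sS.
- by move/(circle_path_far si sS).
- by move/esym/(circle_path_far ri rS).
- by move/base_points_inj.
Qed.

Definition half_twist_conf i t : ordered_conf :=
  mk_conf (@half_twist_points_inj i t).

Lemma continuous_ptws (T V : topologicalType) (U : Type)
    (f : T -> {ptws U -> V}) :
  (forall u, continuous (fun t => f t u)) -> continuous f.
Proof.
move=> cf t; apply/cvg_sup => u W.
exact: (@continuous_comp_initial _ _ _ (fun g : {ptws U -> V} => g u) f (cf u)).
Qed.

Lemma continuous_circle_path a b : continuous (circle_path a b).
Proof.
apply: continuous_pairT => t.
  apply: cvgD; first exact: cvg_cst.
  apply: cvgM; first exact: cvg_cst.
  exact: continuous_cos.
apply: cvgM; first exact: cvg_cst.
exact: continuous_sin.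
Qed.

Lemma continuous_half_twist_points i r :
  continuous (fun t => half_twist_points i t r).
Proof.
rewrite /half_twist_points; case: (r == i :> nat).
  apply: (continuous_compT (f := fun t => t + pi)
            (g := circle_path (2 * i.+1%:R + 1) 1)).
    by move=> t; apply: cvgD; [exact: cvg_id|exact: cvg_cst].
  exact: continuous_circle_path.
case: (r == i.+1 :> nat); first exact: continuous_circle_path.
exact: cst_continuous.
Qed.

Lemma continuous_half_twist_conf i : continuous (half_twist_conf i).
Proof.
apply: continuous_comp_initial; apply: continuous_ptws => r.
exact: (@continuous_half_twist_points i r).
Qed.

(* The parameter interval [[0, pi]] is rescaled to the unit interval. *)
Definition half_twist_fun (i : 'I_k.-1) (t : unit_interval R) :
    unordered_conf :=
  conf_pi (half_twist_conf i (pi * valI t)).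

Lemma half_twist_cts i : continuous (half_twist_fun i).
Proof.
apply: (continuous_compT (g := conf_pi)); last exact: continuous_conf_pi.
apply: (continuous_compT (g := half_twist_conf i)); last first.
  exact: continuous_half_twist_conf.
apply: (continuous_compT (f := @valI R) (g := fun x => pi * x)).
  exact: continuous_valI.
by move=> x; apply: cvgM; [exact: cvg_cst|exact: cvg_id].
Qed.

Lemma half_twist_zero i : half_twist_fun i zero = base_conf.
Proof.
apply/conf_piP; exists 1%g => r; rewrite perm1 /conf_point /=.
rewrite clampIE ?lexx ?ler01 // mulr0 /half_twist_points /circle_path.
rewrite add0r cospi sinpi cos0 sin0 !mul1r /base_points.
case: eqVneq => [->|_]; first by congr (_, _); lra.
by case: eqVneq => [->|_] //; congr (_, _); rewrite -(natr1 i.+1); lra.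
Qed.

Lemma half_twist_one i : half_twist_fun i one = base_conf.
Proof.
have k0 : (0 < k)%N by case: (k) i => [[]|].
have ik : (i < k)%N by apply: leq_trans (ltn_ord i) (leq_pred _).
have iSk : (i.+1 < k)%N by rewrite -ltn_predRL; exact: ltn_ord.
apply/conf_piP; exists (tperm (Ordinal ik) (Ordinal iSk)) => r.
rewrite /conf_point /= clampIE ?lexx ?ler01 // mulr1.
rewrite /half_twist_points /circle_path cosDpi sinDpi cospi sinpi !mul1r.
rewrite /base_points; case: tpermP => [->|->|/eqP rs /eqP rt] /=.
- rewrite gtn_eqF // eqxx; congr (_, _); lra.
- rewrite eqxx oppr0 opprK; congr (_, _); rewrite -(natr1 i.+1); lra.
- by rewrite -val_eqE /= in rs; rewrite -val_eqE /= in rt; rewrite !ifN.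
Qed.

Definition half_twist_loop (i : 'I_k.-1) : loop R base_conf :=
  mk_path (@half_twist_cts i) (half_twist_zero i) (half_twist_one i).

End configuration_spaces.

(* Main.v *)
From HB Require Import structures.
Require Import Defs.
From mathcomp Require Import all_boot all_order all_algebra perm.
From mathcomp Require Import all_classical all_reals topology.
From mathcomp Require Import normedtype trigo homotopy ring lra zify.

(* Ordering the points of a configuration by first coordinate (ties broken by
   the second) splits the configuration space into a cell of sorted
   configurations, which is convex, and walls where two neighbours exchange.
   Each configuration is joined to the base point inside its cell, so every
   segment of configurations closes up to a loop; crossing a wall gives a
   half-twist. All configurations whose second coordinates are increasing in the
   labels form one convex set meeting every order of the first coordinates, and
   the braid relations hold because loops in it are trivial.

   Conversely, a permutation s has a positive lift to the braid group, and two
   nearby configurations p, q, ranked by X_p, X_q along the first axis and by Y_p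
   along the second, are assigned the braid
   lift(Y_p^-1 X_p)^-1 lift(Y_p^-1 X_q). Points exchanged along one axis are far
   apart along the other, which makes this a locally trivial cocycle; its
   holonomy is a left inverse of the canonical homomorphism. Surjectivity follows
   by cutting a loop into pieces that are homotopic to short segments. *)

(** The permutation [Y_p^-1 X_p] sends the height of a point to its horizontal position, so the
    labels cancel in it and the assigned braid depends on the unordered configurations only.
    Products of permutations are read from left to right: right multiplication by an adjacent
    transposition exchanges two neighbouring positions.

    Heights are the right reference because of the direction of the half-twist. The lower point
    moves to the right, so with labels increasing upwards every new inversion is created by a
    positive crossing, and the segment from the identity order to the order of s represents the
    positive lift of s.

    The lift is not multiplicative and the reference order changes along a path, so the cocycle
    identity is only available locally. A change of reference multiplies both permutations on the
    left by one factor; both lifts then change by a common left factor, which cancels provided that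
    no pair changes its order along both axes. *)

Set Implicit Arguments.
Unset Strict Implicit.
Unset Printing Implicit Defensive.

Import Order.TTheory GRing.Theory Num.Theory.
Import numFieldNormedType.Exports.

(** * The positive lift of permutations *)

(** Only equality tests without a conditional on their left side are split, so in nested values of
    [st] the inner tests are decided first. *)
Ltac eq_cases := repeat match goal with |- context [@eq_op ?T ?a ?b] =>
  lazymatch a with
  | context [if _ then _ else _] => fail
  | _ => case: (@eqP T a b) => ?
  end end; lia.

Section adjacent_transpositions.
Context {n : nat}.
Implicit Types (i j : 'I_n) (s t : 'S_n.+1).
Local Open Scope group_scope.

Definition lo i : 'I_n.+1 := widen_ord (leqnSn n) i.
Definition hi i : 'I_n.+1 := lift ord0 i.
Definition st i : 'S_n.+1 := tperm (lo i) (hi i).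

Arguments lo : simpl never.
Arguments hi : simpl never.
Arguments st : simpl never.

Lemma lo_val i : lo i = i :> nat. Proof. by []. Qed.
Lemma hi_val i : hi i = i.+1 :> nat. Proof. by []. Qed.

Lemma lo_neq_hi i : (lo i != hi i).
Proof. by apply/eqP => /(congr1 (@nat_of_ord _)); rewrite lo_val hi_val; lia. Qed.

Lemma lo_lt_hi i : (lo i < hi i)%N.
Proof. by rewrite hi_val. Qed.

Lemma st_lo i : st i (lo i) = hi i. Proof. exact: tpermL. Qed.
Lemma st_hi i : st i (hi i) = lo i. Proof. exact: tpermR. Qed.

Lemma stK i : st i * st i = 1. Proof. exact: tperm2. Qed.

Lemma st_inv i : involutive (st i).
Proof. exact: tpermK. Qed.

Lemma mulstK i s : s * st i * st i = s.
Proof. by rewrite -mulgA stK mulg1. Qed.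

Lemma st_val i (x : 'I_n.+1) : st i x =
  (if x == i :> nat then i.+1 else if x == i.+1 :> nat then i : nat else x) :> nat.
Proof.
rewrite /st; case: (tpermP _ _ x) => [->|->|xl xh].
- by rewrite lo_val hi_val eqxx.
- by rewrite lo_val hi_val eqxx gtn_eqF.
- case: eqP => [e|_]; first by case: xl; apply: ord_inj.
  by case: eqP => [e|//]; case: xh; apply: ord_inj; rewrite hi_val.
Qed.

Lemma st_mono i (a b : 'I_n.+1) :
  (a < b)%N -> (a, b) <> (lo i, hi i) -> (st i a < st i b)%N.
Proof.
move=> ab abi.
have {}abi : ~ (a = i :> nat /\ b = i.+1 :> nat).
  by move=> [ai bi]; apply: abi; congr (_, _); apply: ord_inj.
by rewrite !st_val; do 4?[case: eqP => ?]; lia.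
Qed.

Lemma st_comm i j : (i.+1 < j)%N -> st i * st j = st j * st i.
Proof.
by move=> ij; apply/permP => x; apply: ord_inj; rewrite !permM !st_val; eq_cases.
Qed.

Lemma st_braid i j : j = i.+1 :> nat -> st i * st j * st i = st j * st i * st j.
Proof.
move=> ij; apply/permP => x; apply: ord_inj; rewrite !permM !st_val ij; eq_cases.
Qed.

Lemma mulst_inv s i x : (s * st i)^-1 x = s^-1 (st i x).
Proof. by rewrite invgM tpermV permM. Qed.

(* A permutation sends items to positions, hence the inverses. *)
Definition asc s i := (s^-1 (lo i) < s^-1 (hi i))%N.

Lemma ascNE s i : ~~ asc s i = (s^-1 (hi i) < s^-1 (lo i))%N.
Proof.
rewrite /asc -leqNgt leq_eqVlt orb_idl // => /eqP/val_inj/perm_inj e.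
by have := lo_neq_hi i; rewrite e eqxx.
Qed.

Lemma asc_mulst s i : asc (s * st i) i = ~~ asc s i.
Proof. by rewrite ascNE /asc !mulst_inv st_lo st_hi. Qed.

(** Monotonicity at neighbours extends to all pairs. A strictly increasing self-map of an initial
    segment lies above the identity, and so does its inverse. *)
Lemma perm_mono1 s : (forall i, s (lo i) < s (hi i))%N -> s = 1.
Proof.
move=> sm.
have mono (a b : 'I_n.+1) : (a < b)%N -> (s a < s b)%N.
  move: a b => a [b bn]; elim: b bn => [|b IH] bn //=; rewrite ltnS => ab.
  have bn' : (b < n)%N by [].
  have -> : Ordinal bn = hi (Ordinal bn') by apply: ord_inj.
  have lob : lo (Ordinal bn') = Ordinal (ltnW bn) by apply: ord_inj.
  move: ab; rewrite leq_eqVlt => /orP[/eqP ab|ab].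
    by have <- : lo (Ordinal bn') = a; [exact/ord_inj/esym|exact: sm].
  by apply: (leq_trans (IH (ltnW bn) ab)); rewrite -lob; exact: ltnW (sm _).
have ge (u : 'S_n.+1) : (forall a b : 'I_n.+1, a < b -> u a < u b)%N ->
    forall x : 'I_n.+1, (x <= u x)%N.
  move=> um [x xn] /=; elim: x xn => [//|x IH] xn.
  by apply: leq_ltn_trans (IH (ltnW xn)) _; apply: um => /=.
have monoV (a b : 'I_n.+1) : (a < b)%N -> (s^-1 a < s^-1 b)%N.
  rewrite -{1}(permKV s a) -{1}(permKV s b) => ab.
  rewrite ltnNge leq_eqVlt; apply/negP => /orP[/eqP/val_inj e|/mono]; last by lia.
  by move: ab; rewrite e ltnn.
apply/permP => x; rewrite perm1; apply: ord_inj; apply/eqP; rewrite eqn_leq.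
by rewrite (ge s mono) -{2}(permK s x) (ge _ monoV).
Qed.

Lemma all_asc1 s : (forall i, asc s i) -> s = 1.
Proof. by move/perm_mono1 => e; rewrite -[s]invgK e invg1. Qed.

Lemma asc1 i : asc 1 i.
Proof. by rewrite /asc invg1 !perm1 hi_val. Qed.

(** These are pairs of positions rather than of labels, so that passing from [s] to [s * st i] moves
    them by [st i]. *)
Definition inversions s : {set 'I_n.+1 * 'I_n.+1} :=
  [set ab : 'I_n.+1 * 'I_n.+1 | (ab.1 < ab.2)%N && (s^-1 ab.2 < s^-1 ab.1)%N].

(** At a descent the pair [(lo i, hi i)] is itself an inversion. Every other pair keeps its order
    under [st i], so applying [st i] to both entries matches the remaining inversions. *)
Lemma card_inversions s i : ~~ asc s i ->
  #|inversions s| = #|inversions (s * st i)|.+1.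
Proof.
rewrite ascNE => si; rewrite (cardsD1 (lo i, hi i)).
have -> : (lo i, hi i) \in inversions s by rewrite inE; apply/andP; split.
rewrite add1n; congr _.+1; pose f (ab : 'I_n.+1 * 'I_n.+1) := (st i ab.1, st i ab.2).
have fK : involutive f.
  by move=> [a b]; rewrite /f /= !st_inv.
rewrite -(card_imset (inversions (s * st i)) (inv_inj fK)); congr #|pred_of_set _|; apply/setP => -[a b].
rewrite (can2_imset_pre _ fK fK) !inE /f /= !mulst_inv !st_inv.
have [ba|_] := ltnP (s^-1 b) (s^-1 a); rewrite ?andbF // !andbT.
apply/andP/idP => [[abi ab]|sab].
  by apply: st_mono => // -[ea eb]; rewrite ea eb eqxx in abi.
have abn : (a, b) <> (lo i, hi i).
  by move=> [ea eb]; move: sab; rewrite ea eb st_lo st_hi; have := lo_lt_hi i; lia.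
split; first exact/eqP.
rewrite -[a](st_inv i) -[b](st_inv i); apply: st_mono => //.
move=> [/(congr1 (st i)) + /(congr1 (st i))].
rewrite !st_inv st_lo st_hi => ea eb.
by move: ba; rewrite ea eb; lia.
Qed.

(** Induction on the Coxeter length: only the identity has no descent, and undoing a descent removes
    one inversion. *)
Lemma asc_ind (P : 'S_n.+1 -> Prop) : P 1 ->
  (forall s i, asc s i -> P s -> P (s * st i)) -> forall s, P s.
Proof.
move=> P1 PS s; have [m] := ubnP #|inversions s|; elim: m s => // m IH s sm.
have [->//|s1] := eqVneq s 1; have [i si] : exists i, ~~ asc s i.
  apply/existsP; apply: contraR s1; rewrite negb_exists => /forallP H.
  by apply/eqP/all_asc1 => i; have := H i; rewrite negbK.
rewrite -(mulstK i s); apply: PS; first by rewrite asc_mulst.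
by apply: IH; move: sm; rewrite (card_inversions si).
Qed.

End adjacent_transpositions.

(** * Matsumoto's theorem for the symmetric group, and change of the reference order *)

Section positive_lift.
Context {n : nat} (G : groupType) (g : 'I_n -> G).
Hypothesis g_braid : forall i j : 'I_n, j = i.+1 :> nat ->
  (g i * g j * g i = g j * g i * g j)%g.
Hypothesis g_comm : forall i j : 'I_n, (i.+1 < j)%N -> (g i * g j = g j * g i)%g.
Implicit Types (i j : 'I_n) (s t : 'S_n.+1).
Local Open Scope group_scope.

(** The argument [m] is fuel, meant to be the number of inversions; a reduced word is read off from
    its right end by picking some descent at each step. *)
Fixpoint lift_rec m s : G :=
  if m is m'.+1 then
    if [pick i | ~~ asc s i] is Some i then lift_rec m' (s * st i) * g i else 1
  else 1.

Definition positive_lift s := lift_rec #|inversions s| s.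

Lemma positive_lift1 : positive_lift 1 = 1.
Proof.
rewrite /positive_lift; case: #|_| => [//|m] /=.
by case: pickP => // i; rewrite asc1.
Qed.

(** Independence of the descent picked. Two descents are reconciled by descending further to a
    common permutation, with the commutation relation when they are far apart and the braid relation
    when they are adjacent. *)
Lemma positive_lift_desc s i : ~~ asc s i ->
  positive_lift s = positive_lift (s * st i) * g i.
Proof.
have [m] := ubnP #|inversions s|; elim: m s i => // m IH s i sm si.
have [j sj ->] : exists2 j, ~~ asc s j &
    positive_lift s = positive_lift (s * st j) * g j.
  rewrite {1}/positive_lift (card_inversions si) /=.
  case: pickP => [j sj|/(_ i)]; last by rewrite si.
  exists j => //; congr (_ * _); rewrite /positive_lift; congr (lift_rec _ _).
  by apply: succn_inj; rewrite -!card_inversions.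
have IH1 j' t : ~~ asc s j' -> t = s * st j' -> forall i', ~~ asc t i' ->
    positive_lift t = positive_lift (t * st i') * g i'.
  move=> sj' -> i'; apply: IH.
  by move: sm; rewrite (card_inversions sj'); lia.
have dec2 j' t : ~~ asc s j' -> forall i', ~~ asc (s * st j') i' ->
    t = s * st j' * st i' -> forall i'', ~~ asc t i'' ->
    positive_lift t = positive_lift (t * st i'') * g i''.
  move=> sj' i' si' -> i''; apply: IH.
  by move: sm; rewrite (card_inversions sj') (card_inversions si'); lia.
wlog ij : i j si sj / (i < j)%N => [H|].
  have [ij|ji|/val_inj->//] := ltngtP i j; first exact: H.
  by apply/esym; exact: H.
have [ij1|] := ltnP i.+1 j.
  have lo_i : st j (lo i) = lo i.
    by apply: ord_inj; rewrite st_val lo_val; eq_cases.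
  have hi_i : st j (hi i) = hi i.
    by apply: ord_inj; rewrite st_val hi_val; eq_cases.
  have lo_j : st i (lo j) = lo j.
    by apply: ord_inj; rewrite st_val lo_val; eq_cases.
  have hi_j : st i (hi j) = hi j.
    by apply: ord_inj; rewrite st_val hi_val; eq_cases.
  rewrite (IH1 j _ sj erefl i); last first.
    by rewrite ascNE !mulst_inv lo_i hi_i -ascNE.
  rewrite (IH1 i _ si erefl j); last first.
    by rewrite ascNE !mulst_inv lo_j hi_j -ascNE.
  by rewrite -!mulgA (g_comm ij1) -(st_comm ij1).
move=> ji; have {ji}ij : j = i.+1 :> nat by lia.
have hl : hi i = lo j by apply: ord_inj; rewrite hi_val.
have stih : st i (hi j) = hi j.
  by apply: ord_inj; rewrite st_val hi_val; eq_cases.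
have stjl : st j (lo i) = lo i.
  by apply: ord_inj; rewrite st_val lo_val; eq_cases.
have stil : st i (lo i) = lo j by rewrite -hl st_lo.
have stim : st i (lo j) = lo i by rewrite -hl st_hi.
move: (si) (sj); rewrite !ascNE hl => si' sj'.
(* The three positions involved are in decreasing order, so both routes descend three times and meet
   at [s] times the longest element on these positions. *)
have s1 : ~~ asc (s * st j) i.
  by rewrite ascNE hl !mulst_inv st_lo stjl; exact: ltn_trans si'.
have s2 : ~~ asc (s * st i) j.
  by rewrite ascNE !mulst_inv stih stim; exact: ltn_trans si'.
have s3 : ~~ asc (s * st j * st i) j.
  by rewrite ascNE !mulst_inv stih stim stjl st_hi.
have s4 : ~~ asc (s * st i * st j) i.
  by rewrite ascNE hl !mulst_inv stjl st_lo stil stih.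
rewrite (IH1 j _ sj erefl i s1) (IH1 i _ si erefl j s2).
rewrite (dec2 j _ sj i s1 erefl j s3) (dec2 i _ si j s2 erefl i s4).
by rewrite -!mulgA (mulgA (st i)) (st_braid ij) (mulgA (g i)) (g_braid ij) !mulgA.
Qed.

Lemma positive_lift_asc s i : asc s i ->
  positive_lift (s * st i) = positive_lift s * g i.
Proof.
move=> si; rewrite (@positive_lift_desc (s * st i) i) ?mulstK //.
by rewrite asc_mulst negbK.
Qed.

(** The lift grows on the right by construction; growth on the left follows by peeling off a right
    descent of [s], which stays a descent of [st j * s] because [s] keeps [lo j] before [hi j]. *)
Lemma positive_lift_left s j : (s (lo j) < s (hi j))%N ->
  positive_lift (st j * s) = g j * positive_lift s.
Proof.
have [m] := ubnP #|inversions s|; elim: m s => // m IH s sm sj.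
have [->|] := eqVneq s 1.
  by rewrite mulg1 -{1}[st j]mul1g positive_lift_asc ?asc1 // positive_lift1 mul1g mulg1.
move=> s1; have [i si] : exists i, ~~ asc s i.
  apply/existsP; apply: contraR s1; rewrite negb_exists => /forallP H.
  by apply/eqP/all_asc1 => i; have := H i; rewrite negbK.
rewrite (positive_lift_desc si).
rewrite (@positive_lift_desc (st j * s) i); last first.
  rewrite ascNE invgM tpermV !permM; move: si; rewrite ascNE => si.
  apply: st_mono => // -[hl lh]; move: sj; rewrite -hl -lh !permKV; rewrite hi_val /=; lia.
rewrite -mulgA IH ?mulgA //.
  by move: sm; rewrite (card_inversions si).
rewrite !permM; apply: st_mono => // -[hl lh]; move: si.
by rewrite /asc -hl -lh !permK hi_val ltnSn.
Qed.

(* Relabelling heights does not change the braid between two orders, as long as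
   no two strands are exchanged both in height and in position. *)
Lemma positive_lift_height t s s' :
  (forall a b : 'I_n.+1, (a < b)%N -> (t b < t a)%N -> (s a < s b)%N = (s' a < s' b)%N) ->
  (positive_lift (t^-1 * s))^-1 * positive_lift (t^-1 * s') =
  (positive_lift s)^-1 * positive_lift s'.
Proof.
have [m] := ubnP #|inversions t^-1|; elim: m t s s' => // m IH t s s' tm H.
have [->|t1] := eqVneq t 1; first by rewrite invg1 !mul1g.
have [j] : exists j, ~~ asc t^-1 j.
  apply/existsP; apply: contraR t1; rewrite negb_exists => /forallP A.
  by rewrite -(inj_eq invg_inj) invg1; apply/eqP/all_asc1 => i; have := A i; rewrite negbK.
move=> tj; move: (tj); rewrite ascNE invgK => tj'.
pose t1' := st j * t.
have t1V : t1'^-1 = t^-1 * st j by rewrite invgM tpermV.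
have tV : t^-1 = t1'^-1 * st j by rewrite t1V mulstK.
(* One transposition [st j] is peeled off [t]. The pair [lo j], [hi j] is inverted by [t], so [s]
   and [s'] order it alike and both lifts change on the left by [g j], or both by its inverse; this
   factor cancels. *)
rewrite tV -!mulgA IH.
- have lh : (lo j < hi j)%N by rewrite hi_val.
  have := H _ _ lh tj'.
  have [sj|sj] := ltnP (s (lo j)) (s (hi j)); move/esym => sj'.
    by rewrite !positive_lift_left // invgM mulgA mulgVK.
  have key (u : 'S_n.+1) : (u (lo j) < u (hi j))%N = false ->
      positive_lift u = g j * positive_lift (st j * u).
    move=> uj; rewrite -positive_lift_left ?mulgA ?stK ?mul1g //.
    rewrite !permM st_lo st_hi ltn_neqAle leqNgt uj andbT val_eqE.
    by rewrite (inj_eq perm_inj) eq_sym lo_neq_hi.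
  rewrite (key s) ?(key s') //; last by rewrite ltnNge sj.
  by rewrite invgM mulgA mulgVK.
- by move: tm; rewrite (card_inversions tj) t1V.
- move=> a b ab; rewrite !permM => tab.
  have abj : (a, b) <> (lo j, hi j).
    by move=> [ea eb]; move: tab; rewrite ea eb st_lo st_hi; lia.
  by apply: H => //; exact: st_mono.
Qed.

End positive_lift.

Local Open Scope classical_set_scope.
Local Open Scope ring_scope.
Local Open Scope quotient_scope.

(** * Paths and their classes *)

Section continuity.
Context {R : realType}.

Definition cl (t : R) : R := Num.max 0 (Num.min 1 t).

Lemma cl_ge0 t : 0 <= cl t. Proof. by rewrite /cl le_max lexx. Qed.

Lemma cl_le1 t : cl t <= 1.
Proof. by rewrite /cl ge_max ler01 /= ge_min lexx. Qed.

Lemma cl_id t : 0 <= t -> t <= 1 -> cl t = t.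
Proof. by move=> t0 t1; rewrite /cl min_r // max_r. Qed.

Lemma cl0 : cl 0 = 0. Proof. by rewrite cl_id. Qed.
Lemma cl1 : cl 1 = 1. Proof. by rewrite cl_id. Qed.

Lemma continuous_cl : continuous cl.
Proof.
exact: (continuous_compT (@continuous_clampI R) (@continuous_valI R)).
Qed.

Lemma continuous_affineT (a b : R) : continuous (fun x : R => a * x + b).
Proof.
by move=> x; apply: cvgD; [apply: cvgM; [exact: cvg_cst|exact: cvg_id]|exact: cvg_cst].
Qed.

Lemma continuous_subT (T : topologicalType) (u v : T -> R) :
  continuous u -> continuous v -> continuous (fun x => u x - v x).
Proof. by move=> cu cv x; apply: cvgB; [exact: cu|exact: cv]. Qed.

Lemma continuous_addT (T : topologicalType) (u v : T -> R) :
  continuous u -> continuous v -> continuous (fun x => u x + v x).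
Proof. by move=> cu cv x; apply: cvgD; [exact: cu|exact: cv]. Qed.

Lemma continuous_mulT (T : topologicalType) (u v : T -> R) :
  continuous u -> continuous v -> continuous (fun x => u x * v x).
Proof. by move=> cu cv x; apply: cvgM; [exact: cu|exact: cv]. Qed.

Lemma continuous_cstT (T T' : topologicalType) (c : T') : continuous (fun _ : T => c).
Proof. by move=> x; exact: cvg_cst. Qed.

Lemma continuous_if_affine (a b a' b' c : R) : a * c + b = a' * c + b' ->
  continuous (fun x : R => if x <= c then a * x + b else a' * x + b').
Proof.
move=> e; apply: (@continuous_pasting R R R id c) => [||| s /= ->//].
- exact: continuous_idT.
- exact: continuous_affineT.
- exact: continuous_affineT.
Qed.

End continuity.

Section real_paths.
Context {R : realType} {X : topologicalType}.
Implicit Types (f g h : R -> X).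

(* Paths are functions on the whole line, of which only the restriction to
   [[0, 1]] matters; this avoids clamping in concatenations. *)
Definition path_homotopic f g : Prop :=
  exists H : R * R -> X,
    [/\ continuous H,
        forall t, H (t, 0) = f (cl t),
        forall t, H (t, 1) = g (cl t),
        forall s, H (0, s) = f 0
      & forall s, H (1, s) = f 1].

Lemma path_homotopicI f g (H : R * R -> X) : continuous H ->
  (forall t : R, 0 <= t -> t <= 1 -> H (t, 0) = f t) ->
  (forall t : R, 0 <= t -> t <= 1 -> H (t, 1) = g t) ->
  (forall s : R, 0 <= s -> s <= 1 -> H (0, s) = f 0) ->
  (forall s : R, 0 <= s -> s <= 1 -> H (1, s) = f 1) ->
  path_homotopic f g.
Proof.
move=> cH H0 H1 Hl Hr; exists (fun z => H (cl z.1, cl z.2)); split=> [|t|t|s|s] /=.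
- apply: (continuous_compT (g := H)) => //; apply: continuous_pairT.
    exact: (continuous_compT (@continuous_fstT R R) continuous_cl).
  exact: (continuous_compT (@continuous_sndT R R) continuous_cl).
- by rewrite cl0 H0 ?cl_ge0 ?cl_le1.
- by rewrite cl1 H1 ?cl_ge0 ?cl_le1.
- by rewrite cl0 Hl ?cl_ge0 ?cl_le1.
- by rewrite cl1 Hr ?cl_ge0 ?cl_le1.
Qed.

Lemma path_homotopic_reparam (p : R -> X) (phi psi : R -> R) f g :
  continuous p -> continuous phi -> continuous psi ->
  phi 0 = psi 0 -> phi 1 = psi 1 ->
  (forall t : R, 0 <= t -> t <= 1 -> f t = p (phi t)) ->
  (forall t : R, 0 <= t -> t <= 1 -> g t = p (psi t)) ->
  path_homotopic f g.
Proof.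
move=> cp cphi cpsi e0 e1 fE gE.
apply: (@path_homotopicI f g
  (fun z => p ((1 - z.2) * phi z.1 + z.2 * psi z.1))) => [|t t0 t1|t t0 t1|s s0 s1|s s0 s1] /=.
- apply: (continuous_compT (g := p)) => //.
  have c1 (u : R -> R) : continuous u -> continuous (fun z : R * R => u z.1).
    by move=> cu; exact: (continuous_compT (@continuous_fstT R R) cu).
  apply: continuous_addT; apply: continuous_mulT; try exact: c1.
  + apply: continuous_subT; [exact: continuous_cstT|exact: continuous_sndT].
  + exact: continuous_sndT.
- by rewrite fE // subr0 mul1r mul0r addr0.
- by rewrite gE // subrr mul1r mul0r add0r.
- by rewrite fE // e0 -mulrDl subrK mul1r.
- by rewrite fE // e1 -mulrDl subrK mul1r.
Qed.

Lemma path_homotopic_ext f g : continuous g ->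
  (forall t : R, 0 <= t -> t <= 1 -> f t = g t) -> path_homotopic f g.
Proof.
by move=> cg fg; apply: (@path_homotopic_reparam g id id) => //; exact: continuous_idT.
Qed.

Lemma path_homotopic_refl f : continuous f -> path_homotopic f f.
Proof. by move=> cf; exact: path_homotopic_ext. Qed.

Lemma path_homotopic_ends f g : path_homotopic f g -> f 0 = g 0 /\ f 1 = g 1.
Proof.
move=> [H [_ _ H1 Hl Hr]].
by split; [rewrite -(Hl 1) H1 cl0|rewrite -(Hr 1) H1 cl1].
Qed.

Lemma path_homotopic_sym f g : path_homotopic f g -> path_homotopic g f.
Proof.
move=> fg; have [e0 e1] := path_homotopic_ends fg; case: fg => H [cH H0 H1 Hl Hr].
apply: (@path_homotopicI g f (fun z => H (z.1, 1 - z.2))) => [|t t0 t1|t t0 t1|s _ _|s _ _] /=.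
- apply: (continuous_compT (g := H)) => //; apply: continuous_pairT.
    exact: continuous_fstT.
  apply: continuous_subT; [exact: continuous_cstT|exact: continuous_sndT].
- by rewrite subr0 H1 cl_id.
- by rewrite subrr H0 cl_id.
- by rewrite Hl.
- by rewrite Hr.
Qed.

Let glue (Y : Type) (H K : R * Y -> X) (z : R * Y) : X :=
  if z.1 <= 1 / 2 then H (2 * z.1, z.2) else K (2 * z.1 - 1, z.2).

Let continuous_glue (Y : topologicalType) (H K : R * Y -> X) :
  continuous H -> continuous K ->
  (forall y, H (1, y) = K (0, y)) -> continuous (glue H K).
Proof.
move=> cH cK HK.
have c (F : R * Y -> X) (a b : R) : continuous F ->
    continuous (fun z : R * Y => F (a * z.1 + b, z.2)).
  move=> cF; apply: (continuous_compT (g := F)) => //; apply: continuous_pairT.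
    exact: (continuous_compT (@continuous_fstT R Y) (@continuous_affineT R a b)).
  exact: continuous_sndT.
apply: continuous_pasting => [|||z ->].
- exact: continuous_fstT.
- by have := c H 2 0 cH; under eq_fun do rewrite addr0.
- exact: (c K 2 (- 1) cK).
- by rewrite mulrC divfK ?pnatr_eq0 // subrr HK.
Qed.

Definition concat f g (t : R) : X := if t <= 1 / 2 then f (2 * t) else g (2 * t - 1).
Definition reversal f (t : R) : X := f (1 - t).

Lemma cat0 f g : concat f g 0 = f 0.
Proof. by rewrite /concat ifT ?mulr0 //; lra. Qed.

Lemma cat1 f g : concat f g 1 = g 1.
Proof.
rewrite /concat ifF; last by apply/negbTE; rewrite -ltNge; lra.
by congr g; lra.
Qed.

Lemma continuous_cat f g : continuous f -> continuous g -> f 1 = g 0 ->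
  continuous (concat f g).
Proof.
move=> cf cg fg.
have := @continuous_glue R (fun z => f z.1) (fun z => g z.1).
move=> /(_ (continuous_compT (@continuous_fstT _ _) cf)).
move=> /(_ (continuous_compT (@continuous_fstT _ _) cg) (fun=> fg)) cfg.
apply: (continuous_compT (f := fun t : R => (t, 0 : R)) (g := glue _ _)) cfg.
by apply: continuous_pairT; [exact: continuous_idT|exact: continuous_cstT].
Qed.

Lemma continuous_reversal f : continuous f -> continuous (reversal f).
Proof.
move=> cf; apply: (continuous_compT (f := fun t : R => 1 - t) (g := f)) => //.
exact: continuous_onesub.
Qed.

Lemma path_homotopic_trans g f h :
  path_homotopic f g -> path_homotopic g h -> path_homotopic f h.
Proof.
move=> fg; have [e0 e1] := path_homotopic_ends fg.
move: fg => [H [cH H0 H1 Hl Hr]] [K [cK K0 K1 Kl Kr]].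
pose sw (F : R * R -> X) z := F (z.2, z.1).
have csw (F : R * R -> X) : continuous F -> continuous (sw F).
  move=> cF; apply: (continuous_compT (g := F)) => //.
  by apply: continuous_pairT; [exact: continuous_sndT|exact: continuous_fstT].
have gE (F F' : R * R -> X) y : glue F F' (0, y) = F (0, y) /\ glue F F' (1, y) = F' (1, y).
  split; rewrite /glue /=; first by rewrite ifT ?mulr0 //; lra.
  rewrite ifF; last by apply/negbTE; rewrite -ltNge; lra.
  by congr (F' (_, _)); lra.
apply: (@path_homotopicI f h (sw (glue (sw H) (sw K)))) => [|t t0 t1|t t0 t1|s _ _|s _ _].
- apply/csw/continuous_glue; [exact: csw|exact: csw|move=> y].
  by rewrite /sw /= H1 K0.
- by rewrite /sw /= (gE _ _ _).1 /= H0 cl_id.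
- by rewrite /sw /= (gE _ _ _).2 /= K1 cl_id.
- by rewrite /sw /glue /=; case: ifP; rewrite ?Hl ?Kl.
- by rewrite /sw /glue /=; case: ifP; rewrite ?Hr ?Kr.
Qed.

Lemma path_homotopic_cat f f' g g' : f 1 = g 0 ->
  path_homotopic f f' -> path_homotopic g g' ->
  path_homotopic (concat f g) (concat f' g').
Proof.
move=> fg [H [cH H0 H1 Hl Hr]] [K [cK K0 K1 Kl Kr]].
apply: (@path_homotopicI _ _ (glue H K)) => [|t t0 t1|t t0 t1|s _ _|s _ _].
- by apply: continuous_glue => // y; rewrite Hr Kl.
- by rewrite /glue /concat /= H0 K0; case: leP => ?; rewrite cl_id //; lra.
- by rewrite /glue /concat /= H1 K1; case: leP => ?; rewrite cl_id //; lra.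
- by rewrite cat0 /glue /= ifT ?mulr0 //; lra.
- rewrite cat1 /glue /= ifF; last by apply/negbTE; rewrite -ltNge; lra.
  by rewrite -(Kr s); congr (K (_, _)); lra.
Qed.

Record path_from_to (x y : X) := PathFromTo {
  path_fun :> R -> X;
  path_continuous : continuous path_fun;
  path_start : path_fun 0 = x;
  path_end : path_fun 1 = y }.

Lemma catp_subproof x y z (p : path_from_to x y) (q : path_from_to y z) :
  [/\ continuous (concat p q), concat p q 0 = x & concat p q 1 = z].
Proof.
split; [|by rewrite cat0 path_start|by rewrite cat1 path_end].
by apply: continuous_cat; rewrite ?path_start ?path_end //; exact: path_continuous.
Qed.

Definition catp x y z (p : path_from_to x y) (q : path_from_to y z) :
    path_from_to x z :=
  let: And3 c a b := catp_subproof p q in PathFromTo c a b.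

Lemma revp_subproof x y (p : path_from_to x y) :
  [/\ continuous (reversal p), reversal p 0 = y & reversal p 1 = x].
Proof.
split; [|by rewrite /reversal subr0 path_end|by rewrite /reversal subrr path_start].
by apply: continuous_reversal; exact: path_continuous.
Qed.

Definition revp x y (p : path_from_to x y) : path_from_to y x :=
  let: And3 c a b := revp_subproof p in PathFromTo c a b.

Definition onep (x : X) : path_from_to x x :=
  PathFromTo (@continuous_cstT _ _ x) erefl erefl.

Lemma catpE x y z (p : path_from_to x y) (q : path_from_to y z) :
  catp p q = concat p q :> (R -> X).
Proof. by rewrite /catp; case: catp_subproof. Qed.

Lemma revpE x y (p : path_from_to x y) : revp p = reversal p :> (R -> X).
Proof. by rewrite /revp; case: revp_subproof. Qed.

End real_paths.

(** * The groupoid laws up to homotopy *)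

Section path_groupoid.
Context {R : realType} {X : topologicalType}.
Implicit Types x y z w : X.

Lemma catpA x y z w (p : @path_from_to R X x y) (q : path_from_to y z)
    (r : path_from_to z w) :
  path_homotopic (catp p (catp q r)) (catp (catp p q) r).
Proof.
(* The breakpoints 1/2 and 3/4 of the left bracketing are carried to 1/4 and 1/2. *)
apply: (@path_homotopic_reparam _ _ (catp (catp p q) r)
  (fun t => if t <= 3 / 4 then (if t <= 1 / 2 then 1 / 2 * t + 0
                       else 1 * t + - (1 / 4)) else 2 * t + - 1) id).
- exact: path_continuous.
- apply: (@continuous_pasting R R R id (3 / 4)
    (fun t => if t <= 1 / 2 then 1 / 2 * t + 0 else 1 * t + - (1 / 4))
    (fun t => 2 * t + - 1)).
  + exact: continuous_idT.
  + by apply: continuous_if_affine; lra.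
  + exact: continuous_affineT.
  + by move=> s ->; rewrite ifF; [lra|apply/negbTE; rewrite -ltNge; lra].
- exact: continuous_idT.
- by rewrite !ifT; lra.
- by rewrite ifF; [lra|apply/negbTE; rewrite -ltNge; lra].
- move=> t t0 t1; rewrite !catpE /concat.
  have gtF (a b : R) : b < a -> (a <= b) = false by move=> ab; rewrite leNgt ab.
  have [h1|h1] := leP t (1 / 2).
    rewrite (_ : (if t <= 3 / 4 then _ else _) = t / 2); last by rewrite ifT; lra.
    rewrite ifT; last lra.
    rewrite ifT; last lra.
    by congr (p _); lra.
  have [h2|h2] := leP t (3 / 4).
    rewrite ifT; last lra.
    rewrite ifT; last lra.
    by rewrite gtF; [congr (q _); lra|lra].
  rewrite gtF; last lra.
  by congr (r _); lra.
- by [].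
Qed.

Lemma cat1p x y (p : @path_from_to R X x y) : path_homotopic (catp (onep x) p) p.
Proof.
apply: (@path_homotopic_reparam _ _ p
  (fun t => if t <= 1 / 2 then 0 * t + 0 else 2 * t + -1) id) => //.
- exact: path_continuous.
- by apply: continuous_if_affine; lra.
- exact: continuous_idT.
- by rewrite ifT; lra.
- by rewrite ifF; [lra|apply/negbTE; rewrite -ltNge; lra].
- move=> t t0 t1; rewrite catpE /concat; case: ifP => // _.
  by rewrite mul0r addr0 path_start.
Qed.

Lemma catp1 x y (p : @path_from_to R X x y) : path_homotopic (catp p (onep y)) p.
Proof.
apply: (@path_homotopic_reparam _ _ p
  (fun t => if t <= 1 / 2 then 2 * t + 0 else 0 * t + 1) id) => //.
- exact: path_continuous.
- by apply: continuous_if_affine; lra.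
- exact: continuous_idT.
- by rewrite ifT; lra.
- by rewrite ifF; [lra|apply/negbTE; rewrite -ltNge; lra].
- move=> t t0 t1; rewrite catpE /concat; case: ifP => // _.
    by rewrite addr0.
  by rewrite mul0r add0r path_end.
Qed.

Lemma catpV x y (p : @path_from_to R X x y) :
  path_homotopic (catp p (revp p)) (onep x).
Proof.
apply: (@path_homotopic_reparam _ _ p
  (fun t => if t <= 1 / 2 then 2 * t + 0 else (- 2) * t + 2) (fun=> 0)) => //.
- exact: path_continuous.
- by apply: continuous_if_affine; lra.
- exact: continuous_cstT.
- by rewrite ifT; lra.
- by rewrite ifF; [lra|apply/negbTE; rewrite -ltNge; lra].
- move=> t t0 t1; rewrite catpE /concat revpE /reversal; case: ifP => // _.
    by rewrite addr0.
  by congr (p _); lra.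
- by move=> t _ _; rewrite path_start.
Qed.

Lemma catVp x y (p : @path_from_to R X x y) :
  path_homotopic (catp (revp p) p) (onep y).
Proof.
apply: (@path_homotopic_reparam _ _ p
  (fun t => if t <= 1 / 2 then (- 2) * t + 1 else 2 * t + - 1) (fun=> 1)) => //.
- exact: path_continuous.
- by apply: continuous_if_affine; lra.
- exact: continuous_cstT.
- by rewrite ifT; lra.
- by rewrite ifF; [lra|apply/negbTE; rewrite -ltNge; lra].
- move=> t t0 t1; rewrite catpE /concat revpE /reversal; case: ifP => // _.
  by congr (p _); lra.
- by move=> t _ _; rewrite path_end.
Qed.

Lemma path_homotopic_catp x y z (p p' : @path_from_to R X x y)
    (q q' : path_from_to y z) :
  path_homotopic p p' -> path_homotopic q q' ->
  path_homotopic (catp p q) (catp p' q').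
Proof.
move=> pp qq; rewrite !catpE; apply: path_homotopic_cat => //.
by rewrite path_start path_end.
Qed.

Lemma path_homotopic_catl x y z (p : @path_from_to R X x y)
    (q q' : path_from_to y z) :
  path_homotopic q q' -> path_homotopic (catp p q) (catp p q').
Proof.
by apply: path_homotopic_catp; apply: path_homotopic_refl; exact: path_continuous.
Qed.

Lemma catp_cancel x y z w (p : @path_from_to R X x y) (c : path_from_to y w)
    (q : path_from_to y z) :
  path_homotopic (catp (catp p c) (catp (revp c) q)) (catp p q).
Proof.
apply: path_homotopic_trans (path_homotopic_sym (catpA _ _ _)) _.
apply: path_homotopic_catl; apply: path_homotopic_trans (catpA _ _ _) _.
apply: path_homotopic_trans (cat1p q); apply: path_homotopic_catp.
  exact: catpV.
by apply: path_homotopic_refl; exact: path_continuous.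
Qed.

End path_groupoid.

(** * From paths to elements of the fundamental group *)

Section class_of_a_path.
Context {R : realType} {X : topologicalType} (x0 : X).
Local Notation I := (unit_interval R).

Lemma valI0 : valI (zero : I) = 0. Proof. by rewrite clampIE ?lexx ?ler01. Qed.
Lemma valI1 : valI (one : I) = 1. Proof. by rewrite clampIE ?lexx ?ler01. Qed.

Section loop_of_path.
Context (p : @path_from_to R X x0 x0).

Let lf (t : I) : X := p (valI t).

Let lf_cts : continuous lf.
Proof.
apply: (continuous_compT (f := @valI R) (g := p)); first exact: continuous_valI.
exact: path_continuous.
Qed.

Let lf0 : lf zero = x0. Proof. by rewrite /lf valI0 path_start. Qed.
Let lf1 : lf one = x0. Proof. by rewrite /lf valI1 path_end. Qed.

Definition loop_of_path : loop R x0 := mk_path lf_cts lf0 lf1.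

Lemma loop_of_pathE t : loop_of_path t = p (valI t). Proof. by []. Qed.

End loop_of_path.

Definition path_class p : fundamental_group R x0 := loop_class (loop_of_path p).

Lemma path_class_eq (p q : path_from_to x0 x0) :
  path_homotopic p q -> path_class p = path_class q.
Proof.
move=> [H [cH H0 H1 Hl Hr]]; apply/loop_classP.
exists (fun z : I * I => H (valI z.1, valI z.2)); split=> [|t|t|s|s].
- apply: (continuous_compT (g := H)) => //; apply: continuous_pairT.
    exact: (continuous_compT (@continuous_fstT I I) (@continuous_valI R)).
  exact: (continuous_compT (@continuous_sndT I I) (@continuous_valI R)).
- by rewrite valI0 H0 cl_id // ?valI_ge0 ?valI_le1.
- by rewrite valI1 H1 cl_id // ?valI_ge0 ?valI_le1.
- by rewrite valI0 Hl path_start.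
- by rewrite valI1 Hr path_end.
Qed.

Lemma path_classM (p q : path_from_to x0 x0) :
  path_class (catp p q) = (path_class p * path_class q)%g.
Proof.
rewrite /path_class; apply: etrans (esym (loop_classM _ _)).
apply/loop_classP/loop_homotopic_ext => t; rewrite loop_of_pathE catpE loop_mulE /concat.
have [t0 t1] := (valI_ge0 t, valI_le1 t).
by case: leP => ?; rewrite loop_of_pathE clampIE //; lra.
Qed.

Lemma path_class_loop (l : loop R x0) (p : path_from_to x0 x0) :
  (forall t, 0 <= t -> t <= 1 -> p t = l (clampI t)) -> path_class p = loop_class l.
Proof.
move=> pl; apply/loop_classP/loop_homotopic_ext => t.
by rewrite loop_of_pathE pl ?valI_ge0 ?valI_le1 // valIK.
Qed.

Context (c : forall x, @path_from_to R X x x0).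

(** A path with arbitrary ends is closed up by the chosen connections [c] to [x0]. The connections
    cancel in products, so this is a functor from the path groupoid to the group. *)
Definition closed_class x y (p : path_from_to x y) : fundamental_group R x0 :=
  path_class (catp (revp (c x)) (catp p (c y))).

Lemma closed_class_eq x y (p q : path_from_to x y) :
  path_homotopic p q -> closed_class p = closed_class q.
Proof.
move=> pq; apply: path_class_eq; apply: path_homotopic_catl.
apply: path_homotopic_catp => //.
by apply: path_homotopic_refl; exact: path_continuous.
Qed.

Lemma closed_classM x y z (p : path_from_to x y) (q : path_from_to y z) :
  closed_class (catp p q) = (closed_class p * closed_class q)%g.
Proof.
rewrite -path_classM; apply/esym/path_class_eq.
apply: path_homotopic_trans (path_homotopic_sym (catpA _ _ _)) _.
apply: path_homotopic_catl; apply: path_homotopic_trans (catp_cancel _ _ _) _.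
exact: catpA.
Qed.

(* Endpoints that are only propositionally equal are handled by this
   extensional form. *)
Lemma closed_class_ext x y x' y' (p : path_from_to x y) (q : path_from_to x' y') :
  (forall t, 0 <= t -> t <= 1 -> p t = q t) -> closed_class p = closed_class q.
Proof.
move=> pq.
have xx : x = x' by rewrite -(path_start p) -(path_start q) pq.
have yy : y = y' by rewrite -(path_end p) -(path_end q) pq.
subst x' y'; apply: closed_class_eq; apply: path_homotopic_ext => //.
exact: path_continuous.
Qed.

Lemma closed_class_loop (l : loop R x0) (p : path_from_to x0 x0) :
  (forall t, c x0 t = x0) ->
  (forall t, 0 <= t -> t <= 1 -> p t = l (clampI t)) -> closed_class p = loop_class l.
Proof.
move=> c0 pl; rewrite -(path_class_loop pl); apply: path_class_eq.
apply: path_homotopic_trans (cat1p p).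
apply: path_homotopic_catp.
  apply: path_homotopic_ext; first exact: path_continuous.
  by move=> t _ _; rewrite revpE /reversal c0.
apply: path_homotopic_trans (catp1 p); apply: path_homotopic_catl.
by apply: path_homotopic_ext; [exact: path_continuous|move=> t _ _; rewrite c0].
Qed.

End class_of_a_path.

Section subpaths.
Context {R : realType} {X : topologicalType}.

Lemma subpath_continuous (f : R -> X) (a b : R) : continuous f ->
  continuous (fun t => f (a + (b - a) * t)).
Proof.
move=> cf; apply: (continuous_compT (f := fun t => a + (b - a) * t)) => // t.
apply: cvgD; first exact: cvg_cst.
by apply: cvgM; [exact: cvg_cst|exact: cvg_id].
Qed.

Lemma subpath_start (f : R -> X) (a b : R) : f (a + (b - a) * 0) = f a.
Proof. by rewrite mulr0 addr0. Qed.

Lemma subpath_end (f : R -> X) (a b : R) : f (a + (b - a) * 1) = f b.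
Proof. by rewrite mulr1 addrC subrK. Qed.

Definition subpath (f : R -> X) (cf : continuous f) (a b : R) :
    @path_from_to R X (f a) (f b) :=
  PathFromTo (@subpath_continuous f a b cf) (subpath_start f a b) (subpath_end f a b).

Lemma subpathE (f : R -> X) (cf : continuous f) a b t :
  subpath cf a b t = f (a + (b - a) * t).
Proof. by []. Qed.

Lemma subpath_cat (f : R -> X) (cf : continuous f) a b d :
  path_homotopic (catp (subpath cf a b) (subpath cf b d)) (subpath cf a d).
Proof.
apply: (@path_homotopic_reparam _ _ f
  (fun t => if t <= 1 / 2 then (2 * (b - a)) * t + a
            else (2 * (d - b)) * t + (2 * b - d)) (fun t => (d - a) * t + a)).
- exact: cf.
- by apply: continuous_if_affine; lra.
- exact: continuous_affineT.
- by rewrite ifT; lra.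
- by rewrite ifF; [lra|apply/negbTE; rewrite -ltNge; lra].
- move=> t t0 t1; rewrite catpE /concat !subpathE.
  by case: ifP => _; congr f; lra.
- by move=> t t0 t1; rewrite subpathE; congr f; lra.
Qed.

End subpaths.

(** * Holonomy of locally trivial cocycles *)

Section interval_induction.
Context {R : realType}.

(** Compactness of the interval in the form of an induction principle: what is additive and holds on
    all short intervals holds on the whole one. *)
Lemma interval_induction (P : R -> R -> Prop) (a b : R) : a <= b ->
  (forall c d e, a <= c -> c <= d -> d <= e -> e <= b -> P c d -> P d e -> P c e) ->
  (forall u, a <= u -> u <= b -> exists2 r, 0 < r &
     forall c d, a <= c -> c <= d -> d <= b -> `|c - u| < r -> `|d - u| < r -> P c d) ->
  P a b.
Proof.
move=> ab tr loc.
pose S : set R := [set c | [/\ a <= c, c <= b & P a c]].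
have Sa : S a.
  split=> //; have [r r0 H] := loc a (lexx a) ab.
  by apply: H => //; rewrite subrr normr0.
have Sub : ubound S b by move=> c [].
have hS : has_sup S by split; [exists a|exists b].
have au : a <= sup S by apply: sup_upper_bound.
have ub : sup S <= b by apply: ge_sup => //; exists a.
have [r r0 H] := loc _ au ub.
have [c [ac cb Pac] cr] := sup_adherent r0 hS.
have cu : c <= sup S by apply: sup_upper_bound.
(* A point strictly past the supremum unless [b] comes first; it satisfies the property as well, so
   it cannot exceed the supremum and must be [b]. *)
pose d := Num.min b (sup S + r / 2).
have ud : sup S <= d by rewrite le_min ub lerDl divr_ge0 // ltW.
have db : d <= b by rewrite ge_min lexx.
have dr : d <= sup S + r / 2 by rewrite ge_min lexx orbT.
have Pad : P a d.
  apply: (tr a c d) => //; first exact: le_trans ud.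
  apply: H => //; first exact: le_trans ud.
  - by rewrite ler0_norm; lra.
  - by rewrite ger0_norm; lra.
have Sd : S d by split=> //; apply: le_trans ud.
have du : d <= sup S by apply: sup_upper_bound.
have -> : b = d; last exact: Pad.
by move: du; rewrite {1}/d ge_min => /orP[bu|]; [apply/eqP; rewrite eq_le db (le_trans bu ud)|lra].
Qed.

End interval_induction.

(* A function [B] to a group that is locally a coboundary transports along
   paths: a development of [B] along [g] is a primitive of [B] on [[0, 1]]. *)
Section monodromy.
Context {R : realType} {X : topologicalType} {G : groupType} (B : X -> X -> G).
Implicit Types (g : R -> X) (F : R -> G) (U : set X).
Local Open Scope group_scope.

Definition trivializing U :=
  exists f : X -> G, forall x y, U x -> U y -> B x y = (f x)^-1 * f y.

Hypothesis locally_trivial : forall x : X, exists2 U : set X, nbhs x U & trivializing U.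

Lemma trivializing_trans U x y z : trivializing U -> U x -> U y -> U z ->
  B x y * B y z = B x z.
Proof. by move=> [f fE] Ux Uy Uz; rewrite !fE // mulgA mulgK. Qed.

Lemma trivializing_id x : B x x = 1.
Proof.
by have [U /nbhs_singleton Ux [f ->//]] := locally_trivial x; rewrite mulVg.
Qed.

(** The condition ranges over every trivializing set containing a piece of the path, not over a
    chosen cover, so developments restrict to subintervals and are compared without common
    refinements. *)
Definition development_on (a b : R) g F := forall c d U, (a <= c)%R -> (c <= d)%R -> (d <= b)%R ->
  trivializing U -> (forall t, (c <= t)%R -> (t <= d)%R -> U (g t)) ->
  (F c)^-1 * F d = B (g c) (g d).

Lemma nearR g (u : R) U : continuous g -> nbhs (g u) U ->
  exists2 r : R, (0 < r)%R & forall t, (`|t - u| < r)%R -> U (g t).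
Proof.
move=> cg /(cg u) /nbhs_ballP[r /= r0 H]; exists r => // t tu.
by apply: H; rewrite /ball /= distrC.
Qed.

Lemma norm_between (c d t u r : R) : (c <= t -> t <= d -> `|c - u| < r -> `|d - u| < r ->
  `|t - u| < r)%R.
Proof. by rewrite !ltr_norml => ct td /andP[c1 c2] /andP[d1 d2]; apply/andP; split; lra. Qed.

Lemma local_development (a b : R) g F : continuous g ->
  (forall u, (a <= u)%R -> (u <= b)%R -> exists2 r : R, (0 < r)%R &
     forall c d, (a <= c)%R -> (c <= d)%R -> (d <= b)%R ->
     (`|c - u| < r)%R -> (`|d - u| < r)%R -> (F c)^-1 * F d = B (g c) (g d)) ->
  development_on a b g F.
Proof.
move=> cg loc c d U ac cd db tU Ug.
apply: (@interval_induction R (fun c d => (F c)^-1 * F d = B (g c) (g d)) c d) => //.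
  move=> x y z cx xy yz zd.
  have [Ux Uy Uz] : [/\ U (g x), U (g y) & U (g z)] by split; apply: Ug; lra.
  move=> xyE yzE; rewrite -(trivializing_trans tU Ux Uy Uz) -xyE -yzE.
  by rewrite mulgA mulgK.
move=> u cu ud; have [||r r0 H] := loc u; [lra..|].
by exists r => // x y cx xy yd xr yr; apply: H => //; lra.
Qed.

Lemma development_exists (a b : R) g : (a <= b)%R -> continuous g ->
  exists F, development_on a b g F.
Proof.
move=> ab cg.
apply: (@interval_induction R (fun a b => exists F, development_on a b g F)) => //.
  move=> c d e ac cd de eb [F FE] [F' FE'].
  (* A left translate of a development is a development; [F'] is translated so as to agree with [F]
     at [d]. *)
  exists (fun t => if (t <= d)%R then F t else F d * (F' d)^-1 * F' t) => x y U cx xy ye tU Ug.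
  have [xd|dx] := leP x d; have [yd|dy] := leP y d.
  - exact: (FE x y U).
  - have [Ux Ud Uy] : [/\ U (g x), U (g d) & U (g y)] by split; apply: Ug; lra.
    rewrite -(trivializing_trans tU Ux Ud Uy).
    rewrite -(FE x d U) //; last by move=> t xt td; apply: Ug => //; lra.
    rewrite -(FE' d y U) //; [by rewrite !mulgA|lra|].
    by move=> t xt td; apply: Ug => //; lra.
  - by exfalso; lra.
  - rewrite -(FE' x y U) //; last lra.
    by set k := F d * _; rewrite invgM -mulgA mulKg.
move=> u au ub; have [U nU tU] := locally_trivial (g u); have [f fE] := tU.
have [r r0 H] := nearR cg nU.
exists r => // c d ac cd db cr dr; exists (f \o g) => x y U' cx xy yd _ _ /=.
by rewrite -fE //; apply: H; apply: norm_between cr dr; lra.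
Qed.

Lemma development_unique (a b : R) g g' F F' : (a <= b)%R -> continuous g ->
  (forall t, (a <= t)%R -> (t <= b)%R -> g t = g' t) ->
  development_on a b g F -> development_on a b g' F' ->
  (F a)^-1 * F b = (F' a)^-1 * F' b.
Proof.
move=> ab cg gg FE FE'.
apply: (@interval_induction R (fun a b => (F a)^-1 * F b = (F' a)^-1 * F' b)) => //.
  move=> c d e _ _ _ _ cdE deE.
  by rewrite -[F e](mulVKg (F d)) mulgA cdE deE -mulgA mulVKg.
move=> u au ub; have [U nU tU] := locally_trivial (g u).
have [r r0 H] := nearR cg nU.
exists r => // c d ac cd db cr dr.
have Ug t : (c <= t)%R -> (t <= d)%R -> U (g t).
  by move=> ct td; apply: H; apply: norm_between cr dr; lra.
rewrite (FE c d U) // (FE' c d U) // ?gg //; try lra.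
by move=> t ct td; rewrite -gg; [exact: Ug|lra|lra].
Qed.

(** A relation rather than a function, so that any convenient development may be exhibited;
    [holonomy_ext] gives uniqueness. *)
Definition holonomy g x := exists F, development_on 0 1 g F /\ (F 0%R)^-1 * F 1%R = x.

Lemma holonomy_exists g : continuous g -> exists x, holonomy g x.
Proof.
by move=> cg; have [F FE] := development_exists (@ler01 R) cg; exists ((F 0%R)^-1 * F 1%R), F.
Qed.

Lemma holonomy_ext g g' x y : continuous g ->
  (forall t, (0 <= t)%R -> (t <= 1)%R -> g t = g' t) ->
  holonomy g x -> holonomy g' y -> x = y.
Proof.
by move=> cg gg [F [FE <-]] [F' [FE' <-]]; exact: development_unique gg FE FE'.
Qed.

Lemma development_affine g F (u v : R) : (0 <= v)%R -> (0 <= u)%R -> (u + v <= 1)%R ->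
  development_on 0 1 g F ->
  development_on 0 1 (fun t => g (u + v * t)%R) (fun t => F (u + v * t)%R).
Proof.
move=> v0 u0 uv FE c d U c0 cd d1 tU Ug.
apply: (FE _ _ U) => //; [by nra|by nra|by nra|move=> t ct td].
have [v0'|v0'] := eqVneq v 0%R.
  have -> : t = (u + v * c)%R by rewrite v0' !mul0r in ct td *; lra.
  exact: Ug.
have -> : t = (u + v * ((t - u) / v))%R by rewrite mulrCA mulfV // mulr1 subrKC.
have vp : (0 < v)%R by rewrite lt_neqAle eq_sym v0'.
by apply: Ug; rewrite ?ler_pdivlMr ?ler_pdivrMr //; lra.
Qed.

Lemma holonomy_concat g g' x y : continuous g -> continuous g' -> g 1%R = g' 0%R ->
  holonomy g x -> holonomy g' y -> holonomy (concat g g') (x * y).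
Proof.
move=> cg cg' gg' gx gy'.
have [F FE] := development_exists (@ler01 R) (continuous_cat cg cg' gg').
exists F; split=> //.
have e1 : (F 0%R)^-1 * F (1 / 2)%R = x.
  have hl : holonomy (fun t => concat g g' (0 + 1 / 2 * t)%R) ((F 0%R)^-1 * F (1 / 2)%R).
    exists (fun t => F (0 + 1 / 2 * t)%R); split.
      by apply: development_affine FE; lra.
    by rewrite mulr0 mulr1 !add0r.
  apply/esym; apply: (holonomy_ext cg _ gx hl) => t t0 t1.
  rewrite /concat ifT; last lra.
  by congr g; lra.
have e2 : (F (1 / 2)%R)^-1 * F 1%R = y.
  have hr : holonomy (fun t => concat g g' (1 / 2 + 1 / 2 * t)%R) ((F (1 / 2)%R)^-1 * F 1%R).
    exists (fun t => F (1 / 2 + 1 / 2 * t)%R); split.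
      by apply: development_affine FE; lra.
    by rewrite mulr0 mulr1 addr0; congr (_ * F _); lra.
  apply/esym; apply: (holonomy_ext cg' _ gy' hr) => t t0 t1.
  rewrite /concat; case: leP => [t2|_]; last by congr g'; lra.
  have -> : t = 0%R by lra.
  by rewrite -gg'; congr g; lra.
by rewrite -e1 -e2 mulgA mulgK.
Qed.

(** The holonomy of [H (_, s)] is locally constant in [s]: neighbouring developments fit into
    squares whose transverse sides are values of [B], and these are trivial at the two ends, which
    the homotopy fixes. *)
Lemma holonomy_homotopic g g' x y : path_homotopic g g' ->
  holonomy g x -> holonomy g' y -> x = y.
Proof.
move=> [H [cH H0 H1 Hl Hr]] gx gy.
have cs s : continuous (fun t => H (t, s)).
  apply: (continuous_compT (g := H)) => //.
  by apply: continuous_pairT; [exact: continuous_idT|exact: continuous_cstT].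
have [F FE] : exists F : R -> R -> G, forall s, development_on 0 1 (fun t => H (t, s)) (F s).
  exists (fun s => sval (cid (development_exists (@ler01 R) (cs s)))) => s.
  by case: cid.
have loc (s0 : R) : exists2 r : R, (0 < r)%R & forall s, (`|s - s0| < r)%R ->
    (F s0 0%R)^-1 * F s0 1%R = (F s 0%R)^-1 * F s 1%R.
  (* The square over [[a, b]] commutes. The radius in [s] belongs to the property, so pasting two
     squares takes the smaller of the two radii. *)
  pose P (a b : R) := exists2 r : R, (0 < r)%R & forall s, (`|s - s0| < r)%R ->
    (F s0 a)^-1 * F s0 b * B (H (b, s0)) (H (b, s)) =
    B (H (a, s0)) (H (a, s)) * ((F s a)^-1 * F s b).
  have [] : P 0%R 1%R.
    apply: (@interval_induction R P); first exact: ler01.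
      move=> c d e _ _ _ _ [r r0 cdE] [r' r0' deE].
      exists (Num.min r r'); first by rewrite lt_min r0 r0'.
      move=> s; rewrite lt_min => /andP[sr sr'].
      rewrite -[F s0 e](mulVKg (F s0 d)) -[F s e](mulVKg (F s d)).
      rewrite (mulgA (F s0 c)^-1) -(mulgA _ _ (B _ _)) deE //.
      by rewrite mulgA cdE // !mulgA.
    move=> u u0 u1; have [U nU tU] := locally_trivial (H (u, s0)).
    have /nbhs_ballP[r /= r0 HU] := cH _ _ nU.
    exists r => // c d c0 cd d1 cr dr; exists r => // s sr.
    have Ut t s' : (c <= t)%R -> (t <= d)%R -> (`|s' - s0| < r)%R -> U (H (t, s')).
      move=> ct td sr'; apply: HU; split=> /=; rewrite /ball /= distrC //.
      exact: norm_between cr dr.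
    have s00 : (`|s0 - s0| < r)%R by rewrite subrr normr0.
    rewrite (FE s0 c d U) //; last by move=> t ct td; exact: Ut.
    rewrite (FE s c d U) //; last by move=> t ct td; exact: Ut.
    by rewrite !(trivializing_trans tU) //; apply: Ut.
  move=> r r0 E; exists r => // s /E.
  by rewrite !Hl !Hr !trivializing_id mul1g mulg1.
pose v s := (F s 0%R)^-1 * F s 1%R.
have key : v 0%R = v 1%R.
  apply: (@interval_induction R (fun s s' => v s = v s')).
  - exact: ler01.
  - by move=> c d e _ _ _ _ -> ->.
  - move=> u _ _; have [r r0 E] := loc u; exists r => // c d _ _ _ cr dr.
    by rewrite /v -(E c) // -(E d).
have hv s : holonomy (fun t => H (t, s)) (v s) by exists (F s).
have -> : x = v 0%R.
  apply/esym; apply: (holonomy_ext (cs 0%R) _ (hv 0%R) gx) => t t0 t1.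
  by rewrite H0 cl_id.
rewrite key; apply: (holonomy_ext (cs 1%R) _ (hv 1%R) gy) => t t0 t1.
by rewrite H1 cl_id.
Qed.

End monodromy.

(** * Orders of the points of a configuration *)

Section order_ranks.
Context {n : nat}.
Implicit Types (lt : rel 'I_n.+1) (a b : 'I_n.+1) (s t : 'S_n.+1).

Lemma rank_fun_subproof lt a : (#|[pred b | lt b a && (b != a)]| < n.+1)%N.
Proof.
rewrite -[X in (_ < X)%N](card_ord n.+1); apply: proper_card.
by apply/properP; split; [exact: subset_predT|exists a => //; rewrite inE eqxx andbF].
Qed.

Definition rank_fun lt a : 'I_n.+1 := Ordinal (rank_fun_subproof lt a).

Definition strict_total lt :=
  [/\ irreflexive lt, transitive lt & forall a b, a != b -> lt a b || lt b a].

Lemma rank_fun_lt lt a b : strict_total lt -> lt a b -> (rank_fun lt a < rank_fun lt b)%N.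
Proof.
move=> [irr tr tot] ab; apply: proper_card; apply/properP; split.
  apply/fintype.subsetP => c; rewrite !inE => /andP[ca _].
  rewrite (tr _ _ _ ca ab) /=; apply: contraTneq ca => ->; apply/negP => ba.
  by have := tr _ _ _ ab ba; rewrite irr.
exists a; rewrite !inE ?eqxx ?andbF // ab /=.
by apply: contraTneq ab => ->; rewrite irr.
Qed.

Lemma rank_fun_inj lt : strict_total lt -> injective (rank_fun lt).
Proof.
move=> slt a b; apply: contra_eq; have [_ _ tot] := slt.
by move=> /tot/orP[]/(rank_fun_lt slt) H; apply/eqP => e; move: H; rewrite e ltnn.
Qed.

(* The permutation sending each label to its rank; the identity when [lt] is
   not a strict total order. *)
Definition rank_perm lt : 'S_n.+1 :=
  if pselect (injective (rank_fun lt)) is left inj then perm inj else 1%g.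

Lemma rank_permP lt a b : strict_total lt ->
  (rank_perm lt a < rank_perm lt b)%N = lt a b.
Proof.
move=> slt; rewrite /rank_perm; case: pselect => [inj|/(_ (rank_fun_inj slt))//].
rewrite !permE; apply/idP/idP => [|/(rank_fun_lt slt)//].
have [irr tr tot] := slt; apply: contraTT => nab.
have [->|ab] := eqVneq a b; first by rewrite ltnn.
rewrite -leqNgt ltnW //; apply: rank_fun_lt => //.
by have := tot _ _ ab; rewrite (negbTE nab).
Qed.

Lemma perm_lt_inj s t : (forall a b, (s a < s b)%N = (t a < t b)%N) -> s = t.
Proof.
move=> st; apply: (mulgI s^-1%g); rewrite mulVg; apply/esym/perm_mono1 => i.
by rewrite !permM -st !permKV; exact: lo_lt_hi.
Qed.

End order_ranks.

(** * Lexicographic orders and straight-line interpolation *)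

Section orders_of_the_plane.
Context {R : realType}.
Implicit Types u v w : R * R.

Definition lexlt u v := (u.1 < v.1) || ((u.1 == v.1) && (u.2 < v.2)).
Definition ylexlt u v := lexlt (u.2, u.1) (v.2, v.1).

Lemma lexlt_irr u : lexlt u u = false.
Proof. by rewrite /lexlt !ltxx andbF. Qed.

Lemma lexlt_trans v u w : lexlt u v -> lexlt v w -> lexlt u w.
Proof.
rewrite /lexlt => /orP[uv|/andP[/eqP-> uv]] /orP[vw|/andP[/eqP<- vw]].
- by rewrite (lt_trans uv vw).
- by rewrite uv.
- by rewrite vw.
- by rewrite eqxx (lt_trans uv vw) orbT.
Qed.

Lemma lexlt_total u v : u != v -> lexlt u v || lexlt v u.
Proof.
move: u v => [a b] [c d]; rewrite xpair_eqE /lexlt /=.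
by case: ltgtP => //= _; case: ltgtP.
Qed.

Lemma lexlt_neq u v : lexlt u v -> u <> v.
Proof. by move=> + e; rewrite e lexlt_irr. Qed.

Lemma strict_total_lexlt n (p : 'I_n.+1 -> R * R) : injective p ->
  strict_total (fun a b => lexlt (p a) (p b)).
Proof.
move=> pinj; split=> [a|b a c|a b ab]; first exact: lexlt_irr.
  exact: lexlt_trans.
by apply: lexlt_total; rewrite (inj_eq pinj).
Qed.

Lemma strict_total_ylexlt n (p : 'I_n.+1 -> R * R) : injective p ->
  strict_total (fun a b => ylexlt (p a) (p b)).
Proof.
move=> pinj; apply: (@strict_total_lexlt n (fun a => ((p a).2, (p a).1))).
by move=> a b /= [e1 e2]; apply: pinj; rewrite [p a]surjective_pairing e1 e2 -surjective_pairing.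
Qed.

Definition lerp2 (t : R) u v : R * R :=
  (u.1 + t * (v.1 - u.1), u.2 + t * (v.2 - u.2)).

Lemma lerp_lt (t a b a' b' : R) : 0 <= t -> t <= 1 -> a < b -> a' < b' ->
  a + t * (a' - a) < b + t * (b' - b).
Proof.
move=> t0 t1 ab ab'; have : 0 <= t * (b' - a') by rewrite mulr_ge0 // subr_ge0 ltW.
move: t1; rewrite le_eqVlt => /orP[/eqP->|t1]; first by lra.
have : 0 < (1 - t) * (b - a) by rewrite mulr_gt0 // subr_gt0.
by lra.
Qed.

(** This is what makes cells convex. If only one of the two comparisons is strict in the first
    coordinate, the interpolated one is strict there too, except at the end where the tie sits;
    there the second coordinate decides. *)
Lemma lerp2_lexlt t u v u' v' : 0 <= t -> t <= 1 ->
  lexlt u v -> lexlt u' v' -> lexlt (lerp2 t u u') (lerp2 t v v').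
Proof.
move=> t0 t1; rewrite /lexlt /lerp2 /=.
move: u v u' v' => [a b] [c d] [a' b'] [c' d'] /=.
move=> /orP[ac|/andP[/eqP<- bd]] /orP[ac'|/andP[/eqP<- bd']].
- by rewrite lerp_lt.
- have [->|t1'] := eqVneq t 1; first by apply/orP; right; rewrite !mul1r !subrKC eqxx.
  have {}t1' : t < 1 by rewrite lt_neqAle t1'.
  by apply/orP; left; nra.
- have [->|t0'] := eqVneq t 0; first by apply/orP; right; rewrite !mul0r !addr0 eqxx.
  have {}t0' : 0 < t by rewrite lt_neqAle eq_sym t0'.
  by apply/orP; left; nra.
- by apply/orP; right; rewrite eqxx /= lerp_lt.
Qed.

End orders_of_the_plane.

(** * Labelled configurations, their ranks and convex cells *)

Section configurations.
Context {R : realType} {n : nat}.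
Local Notation config := ('I_n.+1 -> R * R).
Local Notation X := (unordered_conf R n.+1).
Implicit Types (p q m : config) (s : 'S_n.+1) (a b : 'I_n.+1).

Definition relabel p s : config := fun a => p (s a).

Lemma relabel_inj p s : injective p -> injective (relabel p s).
Proof. by move=> pinj a b /pinj/perm_inj. Qed.

(** Total, with the base point as default value on maps that are not injective, so that formulas
    carry no injectivity proofs. *)
Definition to_conf p : X :=
  if pselect (injective p) is left pinj then conf_pi (mk_conf pinj)
  else base_conf R n.+1.

Lemma to_confE p (pinj : injective p) : to_conf p = conf_pi (mk_conf pinj).
Proof.
rewrite /to_conf; case: pselect => // pinj'.
by apply/conf_piP; exists 1%g => r; rewrite perm1.
Qed.

Lemma to_conf_eqP p q : injective p -> injective q ->
  to_conf p = to_conf q <-> exists s, q = relabel p s.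
Proof.
move=> pinj qinj; rewrite !to_confE conf_piP; split=> -[s sE]; exists s.
  by apply/funext => r; exact: sE.
by move=> r; rewrite /conf_point /= sE.
Qed.

Lemma to_conf_relabel p s : injective p -> to_conf (relabel p s) = to_conf p.
Proof.
by move=> pinj; apply/esym/to_conf_eqP; [|exact: relabel_inj|exists s].
Qed.

Lemma to_conf_surj (x : X) : exists2 p, injective p & to_conf p = x.
Proof.
rewrite -[x]reprK; case: (repr x) => p pinj.
have pinj' : injective p by move: (pinj); rewrite inE.
exists p => //; rewrite to_confE /conf_pi; congr (\pi_(X) _).
by apply: val_inj.
Qed.

Lemma to_conf_base : to_conf (@base_points R n.+1) = base_conf R n.+1.
Proof. by rewrite (to_confE (@base_points_inj R n.+1)). Qed.

Definition config_continuous (T : topologicalType) (f : T -> config) :=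
  forall r, continuous (fun t => f t r).

Lemma continuous_to_conf (T : topologicalType) (f : T -> config) :
  config_continuous f -> (forall t, injective (f t)) ->
  continuous (fun t => to_conf (f t)).
Proof.
move=> cf finj.
have -> : (fun t => to_conf (f t)) = (fun t => conf_pi (mk_conf (@finj t))).
  by apply/funext => t; rewrite to_confE.
apply: (continuous_compT (g := @conf_pi R n.+1)); last exact: continuous_conf_pi.
by apply: continuous_comp_initial; apply: continuous_ptws => r; exact: cf.
Qed.

Definition lerp t p q : config := fun r => lerp2 t (p r) (q r).

Lemma lerp0 p q : lerp 0 p q = p.
Proof. by apply/funext => r; rewrite /lerp /lerp2 !mul0r !addr0; case: (p r). Qed.

Lemma lerp1 p q : lerp 1 p q = q.
Proof. by apply/funext => r; rewrite /lerp /lerp2 !mul1r !subrKC; case: (q r). Qed.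

Lemma lerpxx t p : lerp t p p = p.
Proof. by apply/funext => r; rewrite /lerp /lerp2 !subrr !mulr0 !addr0; case: (p r). Qed.

Lemma config_continuous_lerp (T : topologicalType) (u : T -> R) (f g : T -> config) :
  continuous u -> config_continuous f -> config_continuous g ->
  config_continuous (fun t => lerp (u t) (f t) (g t)).
Proof.
move=> cu cf cg r.
have c1 (h : T -> config) : config_continuous h -> continuous (fun t => (h t r).1).
  by move=> ch; exact: (continuous_compT (ch r) (@continuous_fstT R R)).
have c2 (h : T -> config) : config_continuous h -> continuous (fun t => (h t r).2).
  by move=> ch; exact: (continuous_compT (ch r) (@continuous_sndT R R)).
apply: continuous_pairT; apply: continuous_addT; [exact: c1| |exact: c2|];
  apply: continuous_mulT => //; apply: continuous_subT; by [exact: c1|exact: c2].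
Qed.

Lemma config_continuous_cst (T : topologicalType) p : config_continuous (fun _ : T => p).
Proof. by move=> r; exact: continuous_cstT. Qed.

Lemma config_continuous_comp (T T' : topologicalType) (h : T -> T') (f : T' -> config) :
  continuous h -> config_continuous f -> config_continuous (fun t => f (h t)).
Proof. by move=> ch cf r; exact: (continuous_compT ch (cf r)). Qed.

Definition xrank p : 'S_n.+1 := rank_perm (fun a b => lexlt (p a) (p b)).
Definition yrank p : 'S_n.+1 := rank_perm (fun a b => ylexlt (p a) (p b)).

Lemma xrankP p a b : injective p -> (xrank p a < xrank p b)%N = lexlt (p a) (p b).
Proof. by move=> /strict_total_lexlt pt; rewrite rank_permP. Qed.

Lemma yrankP p a b : injective p -> (yrank p a < yrank p b)%N = ylexlt (p a) (p b).
Proof. by move=> /strict_total_ylexlt pt; rewrite rank_permP. Qed.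

Lemma xrank_relabel p s : injective p -> xrank (relabel p s) = (s * xrank p)%g.
Proof.
move=> pinj; apply: perm_lt_inj => a b.
by rewrite xrankP ?permM ?xrankP //; exact: relabel_inj.
Qed.

Lemma yrank_relabel p s : injective p -> yrank (relabel p s) = (s * yrank p)%g.
Proof.
move=> pinj; apply: perm_lt_inj => a b.
by rewrite yrankP ?permM ?yrankP //; exact: relabel_inj.
Qed.

(* Convex sets of configurations, each pair of labels being separated either by
   the lexicographic order or by the second coordinate. *)
Definition cell (xo yo : 'I_n.+1 -> 'I_n.+1 -> Prop) p : Prop :=
  forall a b, (xo a b -> lexlt (p a) (p b)) /\ (yo a b -> (p a).2 < (p b).2).

Definition convex_conf (D : config -> Prop) : Prop :=
  (forall p, D p -> injective p) /\
  (forall t p q, 0 <= t -> t <= 1 -> D p -> D q -> D (lerp t p q)).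

Lemma convex_cell (xo yo : 'I_n.+1 -> 'I_n.+1 -> Prop) :
  (forall a b, a != b -> [\/ xo a b, xo b a, yo a b | yo b a]) ->
  convex_conf (cell xo yo).
Proof.
move=> tot; split=> [p Dp a b pab|t p q t0 t1 Dp Dq a b].
  apply/eqP/negPn/negP => /tot[] h.
  - by have /lexlt_neq := (Dp a b).1 h.
  - by have /lexlt_neq := (Dp b a).1 h; rewrite pab.
  - by have := (Dp a b).2 h; rewrite pab ltxx.
  - by have := (Dp b a).2 h; rewrite pab ltxx.
have [p1 p2] := Dp a b; have [q1 q2] := Dq a b; split=> h.
  by apply: lerp2_lexlt; [| |exact: p1|exact: q1].
by apply: lerp_lt; [| |exact: p2|exact: q2].
Qed.

Definition xcell s : config -> Prop :=
  cell (fun a b => (s a < s b)%N) (fun _ _ => False).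

Lemma convex_xcell s : convex_conf (xcell s).
Proof.
apply: convex_cell => a b ab; case: (ltngtP (s a) (s b)) => h.
- by constructor 1.
- by constructor 2.
- by move: ab; rewrite -(inj_eq (@perm_inj _ s)) -val_eqE /= h eqxx.
Qed.

Lemma xcell_xrank p : injective p -> xcell (xrank p) p.
Proof. by move=> pinj a b; split=> //; rewrite xrankP. Qed.

Lemma xrank_xcell s p : xcell s p -> xrank p = s.
Proof.
move=> sp; have pinj := (convex_xcell s).1 _ sp.
apply: perm_lt_inj => a b; rewrite xrankP //; apply/idP/idP => [pab|]; last first.
  exact: (sp a b).1.
rewrite ltnNge; apply/negP => sba.
have [e|ne] := eqVneq a b; first by move: pab; rewrite e lexlt_irr.
have : (s b < s a)%N.
  by rewrite ltn_neqAle sba andbT val_eqE (inj_eq perm_inj) eq_sym.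
by move/(sp b a).1 => /(lexlt_trans pab); rewrite lexlt_irr.
Qed.

Lemma lexlt_base_points a b : (a < b)%N ->
  lexlt (base_points R a) (base_points R b).
Proof. by move=> ab; rewrite /lexlt /= ltr_pM2l // ltr_nat ltnS ab. Qed.

Definition sorted_base s : config := relabel (@base_points R n.+1) s.

Lemma xcell_sorted_base s : xcell s (sorted_base s).
Proof. by move=> a b; split=> // ab; exact: lexlt_base_points. Qed.

End configurations.

(** * Straight segments of configurations *)

Section segments.
Context {R : realType} {n : nat}.
Local Notation config := ('I_n.+1 -> R * R).
Local Notation X := (unordered_conf R n.+1).
Local Notation base := (base_conf R n.+1).
Implicit Types (p q m : config) (s : 'S_n.+1) (a b : 'I_n.+1).

Section segment.
Context (D : config -> Prop) (cD : convex_conf D) (p q : config) (Dp : D p) (Dq : D q).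

Lemma segment_continuous : continuous (fun t : R => to_conf (lerp (cl t) p q)).
Proof.
apply: continuous_to_conf => [|t].
  apply: config_continuous_lerp; [exact: continuous_cl|exact: config_continuous_cst..].
by apply: cD.1; apply: cD.2 => //; [exact: cl_ge0|exact: cl_le1].
Qed.

Lemma segment_start : to_conf (lerp (cl 0) p q) = to_conf p.
Proof. by rewrite cl0 lerp0. Qed.

Lemma segment_end : to_conf (lerp (cl 1) p q) = to_conf q.
Proof. by rewrite cl1 lerp1. Qed.

Definition segment : path_from_to (to_conf p) (to_conf q) :=
  PathFromTo segment_continuous segment_start segment_end.

End segment.

Lemma lerp_relabel t p q s : relabel (lerp t p q) s = lerp t (relabel p s) (relabel q s).
Proof. by []. Qed.

(** The formula is asked for every labelling of [x], which makes the chosen one immaterial: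
    relabelling acts alike on both ends of the segment. *)
Lemma connection_exists (x : X) :
  exists c : @path_from_to R X x base, forall p, injective p -> to_conf p = x ->
    forall t, c t = to_conf (lerp (cl t) p (sorted_base (xrank p))).
Proof.
have [p pinj <-] := to_conf_surj x.
have Db : to_conf (sorted_base (xrank p)) = base.
  by rewrite to_conf_relabel ?to_conf_base //; exact: base_points_inj.
rewrite -Db; exists (segment (convex_xcell (xrank p)) (xcell_xrank pinj)
  (xcell_sorted_base _)) => q qinj /esym/to_conf_eqP => /(_ pinj qinj)[s ->] t /=.
rewrite xrank_relabel //.
have -> : sorted_base (s * xrank p)%g = relabel (@sorted_base R n (xrank p)) s.
  by apply/funext => a; rewrite /sorted_base /relabel permM.
rewrite -lerp_relabel to_conf_relabel //.
apply: (convex_xcell (xrank p)).1; apply: (convex_xcell (xrank p)).2.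
- exact: cl_ge0.
- exact: cl_le1.
- exact: xcell_xrank.
- exact: xcell_sorted_base.
Qed.

Definition connection (x : X) : @path_from_to R X x base :=
  sval (cid (connection_exists x)).

Lemma connectionE (x : X) p t : injective p -> to_conf p = x ->
  connection x t = to_conf (lerp (cl t) p (sorted_base (xrank p))).
Proof. by move=> pinj px; rewrite /connection; case: cid => c /= cE; exact: cE. Qed.

Lemma xrank_base : xrank (@base_points R n.+1) = 1%g.
Proof.
apply: xrank_xcell => a b; split=> //; rewrite !perm1; exact: lexlt_base_points.
Qed.

Lemma connection_base t : connection base t = base.
Proof.
have := connectionE t (@base_points_inj R n.+1) (@to_conf_base R n).
rewrite xrank_base => ->; have -> : sorted_base 1%g = @base_points R n.+1.
  by apply/funext => a; rewrite /sorted_base /relabel perm1.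
by rewrite lerpxx to_conf_base.
Qed.

Definition conf_class x y (p : @path_from_to R X x y) : fundamental_group R base :=
  closed_class connection p.

(* The junk value [1] is taken when no convex set of configurations contains
   both ends. *)
Definition seg_class p q : fundamental_group R base :=
  if pselect (exists D, [/\ convex_conf D, D p & D q]) is left H
  then let: And3 cD Dp Dq := proj2_sig (cid H) in conf_class (segment cD Dp Dq)
  else 1%g.

Lemma seg_classE D (cD : convex_conf D) p q (Dp : D p) (Dq : D q) :
  seg_class p q = conf_class (segment cD Dp Dq).
Proof.
rewrite /seg_class; case: pselect => [H|[]]; last by exists D.
by case: (cid H) => D' [cD' Dp' Dq'] /=; apply: closed_class_ext => t _ _.
Qed.

(** Inside a convex set a path is deformed along straight lines onto the segment between its ends,
    so its class depends only on the lifted ends. *)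
Lemma conf_class_seg D (f : R -> config) x y (g : @path_from_to R X x y) :
  convex_conf D -> config_continuous f ->
  (forall t, 0 <= t -> t <= 1 -> D (f t)) ->
  (forall t, 0 <= t -> t <= 1 -> g t = to_conf (f t)) ->
  conf_class g = seg_class (f 0) (f 1).
Proof.
move=> cD cf Df gE.
have D0 : D (f 0) by apply: Df.
have D1 : D (f 1) by apply: Df.
rewrite (seg_classE cD D0 D1).
have x0 : x = to_conf (f 0) by rewrite -(path_start g) gE.
have y1 : y = to_conf (f 1) by rewrite -(path_end g) gE.
subst x y; apply: closed_class_eq.
apply: (@path_homotopicI _ _ _ _ (fun z =>
  to_conf (lerp (cl z.2) (f (cl z.1)) (lerp (cl z.1) (f 0) (f 1))))) => [|t t0 t1|t t0 t1|s _ _|s _ _] /=.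
- apply: continuous_to_conf => [|z].
    have c1 : continuous (fun z : R * R => cl z.1).
      exact: (continuous_compT (@continuous_fstT R R) (@continuous_cl R)).
    apply: config_continuous_lerp.
    + exact: (continuous_compT (@continuous_sndT R R) (@continuous_cl R)).
    + exact: config_continuous_comp c1 cf.
    + apply: config_continuous_lerp => //; exact: config_continuous_cst.
  apply: cD.1; apply: cD.2; rewrite ?cl_ge0 ?cl_le1 //.
    by apply: Df; rewrite ?cl_ge0 ?cl_le1.
  by apply: cD.2; rewrite ?cl_ge0 ?cl_le1.
- by rewrite cl0 lerp0 cl_id // gE.
- by rewrite cl1 lerp1.
- by rewrite !cl0 lerp0 lerpxx path_start.
- by rewrite !cl1 lerp1 lerpxx path_end.
Qed.

Lemma seg_classM D p q m : convex_conf D -> D p -> D q -> D m ->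
  (seg_class p q * seg_class q m)%g = seg_class p m.
Proof.
move=> cD Dp Dq Dm; rewrite (seg_classE cD Dp Dq) (seg_classE cD Dq Dm).
rewrite /conf_class -closed_classM.
pose f (t : R) := if t <= 1 / 2 then lerp (cl (2 * t)) p q else lerp (cl (2 * t - 1)) q m.
rewrite -[closed_class _ _]/(conf_class _) (@conf_class_seg D f).
- rewrite /f ifT; last lra.
  rewrite ifF; last by apply/negbTE; rewrite -ltNge; lra.
  by rewrite mulr0 cl0 lerp0 (_ : 2 * 1 - 1 = 1 :> R) ?cl1 ?lerp1 //; lra.
- exact: cD.
- move=> r.
  have -> : (fun t => f t r) = (fun t => if t <= 1 / 2 then lerp (cl (2 * t)) p q r
      else lerp (cl (2 * t - 1)) q m r) by apply/funext => t; rewrite /f; case: ifP.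
  have c0 (a b : R) (u v : config) : continuous (fun t => lerp (cl (a * t + b)) u v r).
    have := @config_continuous_lerp R n R (fun t => cl (a * t + b)) (fun=> u) (fun=> v).
    apply; [|exact: config_continuous_cst..].
    exact: (continuous_compT (@continuous_affineT R a b) (@continuous_cl R)).
  apply: (@continuous_pasting R R _ id (1 / 2)) => [|||t ->].
  + exact: continuous_idT.
  + by have := c0 2 0 p q; under eq_fun do rewrite addr0.
  + exact: (c0 2 (- 1)).
  + rewrite (_ : 2 * (1 / 2) = 1) ?subrr; last lra.
    by rewrite cl1 cl0 lerp1 lerp0.
- by move=> t _ _; rewrite /f; case: ifP => _; apply: cD.2; rewrite ?cl_ge0 ?cl_le1.
- by move=> t _ _; rewrite catpE /concat /f; case: ifP.
Qed.

Lemma seg_class1 D p : convex_conf D -> D p -> seg_class p p = 1%g.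
Proof.
move=> cD Dp; apply: (mulgI (seg_class p p)).
by rewrite (seg_classM cD) // mulg1.
Qed.

Lemma seg_classV D p q : convex_conf D -> D p -> D q ->
  seg_class q p = ((seg_class p q)^-1)%g.
Proof.
move=> cD Dp Dq; apply: (mulgI (seg_class p q)).
by rewrite (seg_classM cD) // mulgV (seg_class1 cD).
Qed.

Lemma seg_class_relabel D p q s : convex_conf D -> D p -> D q ->
  seg_class (relabel p s) (relabel q s) = seg_class p q.
Proof.
move=> cD Dp Dq; rewrite (seg_classE cD Dp Dq).
pose D' m := exists2 m', D m' & m = relabel m' s.
have cD' : convex_conf D'.
  split=> [_ [m /cD.1 minj ->]|t _ _ t0 t1 [m1 D1 ->] [m2 D2 ->]].
    exact: relabel_inj.
  by exists (lerp t m1 m2) => //; exact: cD.2.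
have Dp' : D' (relabel p s) by exists p.
have Dq' : D' (relabel q s) by exists q.
rewrite (seg_classE cD' Dp' Dq'); apply: closed_class_ext => t t0 t1 /=.
rewrite -lerp_relabel to_conf_relabel //.
by apply: cD.1; apply: cD.2; rewrite ?cl_ge0 ?cl_le1.
Qed.

Lemma conf_class_connection x : conf_class (connection x) = 1%g.
Proof.
pose c := connection x.
have -> : conf_class c = path_class (onep base).
  apply: path_class_eq; apply: path_homotopic_trans (catVp c).
  apply: path_homotopic_catl; apply: path_homotopic_trans (catp1 c).
  apply: path_homotopic_catl; apply: path_homotopic_ext; first exact: path_continuous.
  by move=> t _ _; rewrite connection_base.
apply: (mulgI (path_class (onep base))); rewrite -path_classM mulg1.
by apply: path_class_eq; exact: cat1p.
Qed.

(** Both ends lie in one cell with [sorted_base], to which they are joined by their own connections,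
    and a connection closes up to a trivial loop. *)
Lemma seg_class_same_order p q : injective p -> injective q ->
  xrank p = xrank q -> seg_class p q = 1%g.
Proof.
have main m : injective m -> seg_class m (sorted_base (xrank m)) = 1%g.
  move=> minj; rewrite -(conf_class_connection (to_conf m)).
  rewrite (seg_classE (convex_xcell _) (xcell_xrank minj) (xcell_sorted_base _)).
  by apply: closed_class_ext => t t0 t1; rewrite (connectionE t minj erefl).
move=> pinj qinj pq; have cD := @convex_xcell R n (xrank p).
have Dp := xcell_xrank pinj; have Ds := @xcell_sorted_base R n (xrank p).
have Dq : xcell (xrank p) q by rewrite pq; exact: xcell_xrank.
rewrite -(seg_classM cD Dp Ds Dq) main // mul1g (seg_classV cD Dq Ds) //.
by rewrite pq main // invg1.
Qed.

End segments.

(** * Half-twists and the braid relations *)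

Section presented_group_hom.
Context (A : choiceType) (rels : word A -> word A -> Prop) (G : groupType) (g : A -> G).
Local Open Scope group_scope.

Definition eval_word (w : word A) : G :=
  foldr (fun l x => (if l.2 then (g l.1)^-1 else g l.1) * x) 1 w.

Lemma eval_word_cat u v : eval_word (u ++ v) = eval_word u * eval_word v.
Proof. by elim: u => [|l u IH] /=; rewrite ?mul1g // IH mulgA. Qed.

Hypothesis g_rels : forall u v, rels u v -> eval_word u = eval_word v.

Lemma eval_word_eq u v : word_eq rels u v -> eval_word u = eval_word v.
Proof.
elim=> {u v} [u v /g_rels//|a b|//|u v _ -> //|u v w _ -> //|u u' v v' _ uu _ vv].
- by rewrite /eval_word /= mulg1; case: b => /=; rewrite ?mulVg ?mulgV.
- by rewrite !eval_word_cat uu vv.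
Qed.

Definition presented_hom (x : presented_group rels) : G := eval_word (repr x).

Lemma presented_hom_pi u : presented_hom (pg_pi rels u) = eval_word u.
Proof. exact/eval_word_eq/pg_repr_pi. Qed.

Lemma presented_homM : {morph presented_hom : x y / x * y}.
Proof.
move=> x y; rewrite -[x]pg_piK -[y]pg_piK pg_mulE !presented_hom_pi.
exact: eval_word_cat.
Qed.

HB.instance Definition _ :=
  isMultiplicative.Build (presented_group rels) G presented_hom presented_homM.

Definition presented_morphism : {multiplicative presented_group rels -> G} :=
  presented_hom.

Lemma presented_hom_gen a : presented_hom (pg_gen rels a) = g a.
Proof. by rewrite presented_hom_pi /= mulg1. Qed.

End presented_group_hom.

Section multiplicative_maps.
Context (G H : groupType) (f : {multiplicative G -> H}).
Local Open Scope group_scope.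

Lemma multiplicative1 : f 1 = 1.
Proof. by apply: (mulgI (f 1)); rewrite -gmulfM !mulg1. Qed.

Lemma multiplicativeV x : f x^-1 = (f x)^-1.
Proof. by apply: (mulgI (f x)); rewrite -gmulfM !mulgV multiplicative1. Qed.

End multiplicative_maps.

(** * Half-twists as segments across a wall *)

Section half_twists.
Context {R : realType} {n : nat}.
Local Notation config := ('I_n.+1 -> R * R).
Local Notation base := (base_conf R n.+1).
Implicit Types (p q w : config) (s : 'S_n.+1) (a b : 'I_n.+1) (i j : 'I_n).

Definition twist i (t : R) : config := @half_twist_points R n.+1 i (pi * t).

Definition twist_class i : fundamental_group R base := loop_class (@half_twist_loop R n.+1 i).

Lemma twist_lo i t : twist i t (lo i) = (2 * i.+1%:R + 1 - cos (pi * t), - sin (pi * t)).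
Proof. by rewrite /twist /half_twist_points eqxx /circle_path cosDpi sinDpi !mul1r. Qed.

Lemma twist_hi i t : twist i t (hi i) = (2 * i.+1%:R + 1 + cos (pi * t), sin (pi * t)).
Proof. by rewrite /twist /half_twist_points hi_val gtn_eqF // eqxx /circle_path !mul1r. Qed.

Lemma twist_far i t a : a != lo i -> a != hi i -> twist i t a = (2 * a.+1%:R, 0).
Proof.
move=> al ah; rewrite /twist /half_twist_points ifN; last first.
  by apply: contraNN al => /eqP e; apply/eqP/ord_inj.
by rewrite ifN //; apply: contraNN ah => /eqP e; apply/eqP/ord_inj; rewrite hi_val.
Qed.

Lemma config_continuous_twist i : config_continuous (twist i).
Proof.
move=> r; apply: (continuous_compT (f := fun t : R => pi * t)
    (g := fun t => @half_twist_points R n.+1 i t r)).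
  by move=> t; apply: cvgM; [exact: cvg_cst|exact: cvg_id].
exact: continuous_half_twist_points.
Qed.

Lemma twist_inj i t : injective (twist i t).
Proof. exact: half_twist_points_inj. Qed.

Lemma twist_lexlt i t a b : (a < b)%N -> ~ (a = lo i /\ b = hi i) ->
  lexlt (twist i t a) (twist i t b).
Proof.
move=> ab abi; rewrite /lexlt; apply/orP; left.
have nat2 (m l : nat) : (m < l)%N -> m.+1%:R + 1 <= l.+1%:R :> R.
  by move=> ml; rewrite natr1 ler_nat ltnS.
have [c1 cN1] := (cos_le1 (pi * t), cos_geN1 (pi * t)).
have [ea|al] := eqVneq a (lo i).
  have bh : b != hi i by apply/eqP => eb; apply: abi.
  have bl : b != lo i by apply: contraTneq ab => ->; rewrite ea ltnn.
  have : (i.+1 < b)%N.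
    rewrite ltn_neqAle -{2}(lo_val i) -ea ab andbT; apply: contraNneq bh => e.
    by apply/eqP/ord_inj; rewrite hi_val.
  by move=> /nat2; rewrite ea twist_lo twist_far //= -(natr1 i.+1); lra.
have [ea|ah] := eqVneq a (hi i).
  have bh : b != hi i by apply: contraTneq ab => ->; rewrite ea ltnn.
  have bl : b != lo i by apply: contraTneq ab => ->; rewrite ea hi_val lo_val; lia.
  by move: ab; rewrite ea hi_val => /nat2; rewrite twist_hi twist_far //= -(natr1 i.+1); lra.
rewrite [twist i t a]twist_far //.
have [eb|bl] := eqVneq b (lo i).
  by move: ab; rewrite eb lo_val => /nat2; rewrite twist_lo /=; lra.
have [eb|bh] := eqVneq b (hi i).
  have : (a < i)%N.
    move: ab; rewrite eb hi_val ltnS leq_eqVlt => /orP[/eqP e|//].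
    by case/eqP: al; apply: ord_inj.
  by move=> /nat2; rewrite eb twist_hi /=; lra.
by rewrite twist_far //= ltr_pM2l // ltr_nat ltnS.
Qed.

(** The midpoint is included: there the first coordinates agree and the lower point [lo i] still
    counts as first, so the order changes just after time 1/2. *)
Lemma twist_left i t : 0 <= t -> t <= 1 / 2 -> xcell 1%g (twist i t).
Proof.
move=> t0 t1 a b; split=> //; rewrite !perm1 => ab.
have pi0 := pi_gt0 R.
have [[-> ->]|] := pselect (a = lo i /\ b = hi i); last exact: twist_lexlt.
rewrite twist_lo twist_hi /lexlt /=.
have c0 : 0 <= cos (pi * t) by apply: cos_ge0_pihalf; apply/andP; split; nra.
have s0 : 0 <= sin (pi * t) by apply: sin_ge0_pi; apply/andP; split; nra.
have := cos2Dsin2 (pi * t); move: c0; rewrite le_eqVlt => /orP[/eqP<-|c0] cs.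
  rewrite subr0 addr0 eqxx ltxx /=; move: s0; rewrite le_eqVlt => /orP[/eqP s0|s0]; last by lra.
  by move: cs; rewrite -s0 !expr0n addr0 => /eqP; rewrite eq_sym oner_eq0.
by apply/orP; left; lra.
Qed.

Lemma twist_right i t : 1 / 2 < t -> t <= 1 -> xcell (st i) (twist i t).
Proof.
move=> t0 t1 a b; split=> //; have pi0 := pi_gt0 R.
have [[-> ->]|abi] := pselect (b = lo i /\ a = hi i) => [_|].
  have c0 : 0 < cos (pi - pi * t).
    by apply: cos_gt0_pihalf; apply/andP; split; nra.
  rewrite twist_lo twist_hi /lexlt /=; apply/orP; left.
  by move: c0; rewrite cosB cospi sinpi; lra.
move=> sab; have H : (st i a, st i b) <> (lo i, hi i).
  move=> [ea eb]; apply: abi; split.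
    by rewrite -(st_inv i b) eb st_hi.
  by rewrite -(st_inv i a) ea st_lo.
have := st_mono sab H; rewrite !st_inv => ab; apply: twist_lexlt => // -[ea eb].
by move: sab; rewrite ea eb st_lo st_hi; have := lo_lt_hi i; lia.
Qed.

(** The exchanged pair is separated by height instead of horizontally, so this convex set reaches
    across the wall. *)
Definition twist_cell i : config -> Prop :=
  cell (fun a b => (a < b)%N /\ ~ (a = lo i /\ b = hi i)) (fun a b => a = lo i /\ b = hi i).

Lemma convex_twist_cell i : convex_conf (twist_cell i).
Proof.
apply: convex_cell => a b.
have [e|e] := pselect (a = lo i /\ b = hi i); first by constructor 3.
have [e'|e'] := pselect (b = lo i /\ a = hi i); first by constructor 4.
rewrite -val_eqE neq_ltn => /orP[ab|ba]; first by constructor 1.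
by constructor 2.
Qed.

Lemma twist_middle i t : 0 < t -> t < 1 -> twist_cell i (twist i t).
Proof.
move=> t0 t1 a b; split=> [[ab abi]|[-> ->]]; first exact: twist_lexlt.
rewrite twist_lo twist_hi /=; have := pi_gt0 R => pi0.
have : 0 < sin (pi * t) by apply: sin_gt0_pi; apply/andP; split; nra.
by lra.
Qed.

(** At times 0 and 1 the exchanged points have equal height and the configuration is outside
    [twist_cell], hence the cuts at 1/4 and 3/4. The outer pieces keep one horizontal order except
    at the crossing, which they avoid, so their classes are trivial. *)
Lemma twist_class_seg i : twist_class i = seg_class (twist i (1 / 4)) (twist i (3 / 4)).
Proof.
have cf : continuous (fun t => to_conf (twist i t)).
  apply: continuous_to_conf; [exact: config_continuous_twist|exact: twist_inj].
have fE t : 0 <= t -> t <= 1 ->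
    to_conf (twist i t) = @half_twist_loop R n.+1 i (clampI t).
  move=> t0 t1; rewrite [LHS](to_confE (@half_twist_points_inj R n.+1 i (pi * t))).
  by rewrite -[RHS]/(@half_twist_fun R n.+1 i (clampI t)) /half_twist_fun clampIE.
have f0 : to_conf (twist i 0) = base by rewrite fE //; exact: (@half_twist_zero R n.+1 i).
have f1 : to_conf (twist i 1) = base by rewrite fE //; exact: (@half_twist_one R n.+1 i).
pose p := PathFromTo cf f0 f1.
have -> : twist_class i = conf_class p.
  apply/esym/closed_class_loop => [t|t t0 t1]; first exact: connection_base.
  exact: fE.
have -> : conf_class p = conf_class (subpath cf 0 1).
  by apply: closed_class_ext => t _ _ /=; rewrite subr0 mul1r add0r.
have sub (u v : R) (D : config -> Prop) : convex_conf D -> u <= v ->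
    (forall t, u <= t -> t <= v -> D (twist i t)) ->
    conf_class (subpath cf u v) = seg_class (twist i u) (twist i v).
  move=> cD uv Df.
  rewrite (@conf_class_seg R n D (fun t => twist i (u + (v - u) * t))) //.
  - by rewrite mulr0 addr0 mulr1 subrKC.
  - apply: config_continuous_comp; last exact: config_continuous_twist.
    by apply: continuous_addT; [exact: continuous_cstT|apply: continuous_mulT;
      [exact: continuous_cstT|exact: continuous_idT]].
  - by move=> t t0 t1; apply: Df; nra.
rewrite /conf_class -(closed_class_eq _ (subpath_cat cf 0 (1 / 4) 1)) closed_classM.
rewrite -(closed_class_eq _ (subpath_cat cf (1 / 4) (3 / 4) 1)) closed_classM.
rewrite -!/(conf_class _) (sub 0 (1 / 4) _ (convex_xcell 1%g)); last 2 first.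
- by lra.
- by move=> t t0 t1; apply: twist_left; lra.
rewrite (sub (1 / 4) (3 / 4) _ (@convex_twist_cell i)); last 2 first.
- by lra.
- by move=> t t0 t1; apply: twist_middle; lra.
rewrite (sub (3 / 4) 1 _ (convex_xcell (st i))); last 2 first.
- by lra.
- by move=> t t0 t1; apply: twist_right; lra.
rewrite seg_class_same_order; [|exact: twist_inj..|]; last first.
  by rewrite !(@xrank_xcell _ _ 1%g) //; apply: twist_left; lra.
rewrite (@seg_class_same_order _ _ (twist i (3 / 4))); [|exact: twist_inj..|]; last first.
  by rewrite !(@xrank_xcell _ _ (st i)) //; apply: twist_right; lra.
by rewrite mul1g mulg1.
Qed.

(* Exchanging two neighbours, the one with the smaller second coordinate moving
   to the right, is a half-twist. *)
Lemma seg_class_swap w w' i : injective w -> injective w' ->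
  xrank w' = (xrank w * st i)%g ->
  (w ((xrank w)^-1%g (lo i))).2 < (w ((xrank w)^-1%g (hi i))).2 ->
  (w' ((xrank w)^-1%g (lo i))).2 < (w' ((xrank w)^-1%g (hi i))).2 ->
  seg_class w w' = twist_class i.
Proof.
move=> winj winj' ww' wy wy'; set s := (xrank w)^-1%g in wy wy'.
pose u := relabel w s; pose u' := relabel w' s.
have uinj : injective u by exact: relabel_inj.
have uinj' : injective u' by exact: relabel_inj.
have xu : xrank u = 1%g by rewrite xrank_relabel // mulVg.
have xu' : xrank u' = st i by rewrite xrank_relabel // ww' mulgA mulVg mul1g.
have Du : twist_cell i u.
  move=> a b; split=> [[ab _]|[-> ->]//].
  by rewrite -xrankP // xu !perm1.
have Du' : twist_cell i u'.
  move=> a b; split=> [[ab abi]|[-> ->]//].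
  by rewrite -xrankP // xu'; apply: st_mono => // -[ea eb]; exact: abi.
have uK (v : config) : relabel (relabel v s) (s^-1)%g = v.
  by apply/funext => a; rewrite /relabel permKV.
rewrite -(uK w) -(uK w') (seg_class_relabel _ (@convex_twist_cell i)) // -/u -/u'.
(* The configurations [u], [u'] and two stages of the twist lie in one convex set. The order of [u]
   is that of the first stage and the order of [u'] that of the second, so only the twist
   contributes. *)
have D1 : twist_cell i (twist i (1 / 4)) by apply: twist_middle; lra.
have D3 : twist_cell i (twist i (3 / 4)) by apply: twist_middle; lra.
rewrite -(seg_classM (@convex_twist_cell i) Du D1 Du').
rewrite -(seg_classM (@convex_twist_cell i) D1 D3 Du') -twist_class_seg.
rewrite seg_class_same_order //; first last.
- by rewrite xu (@xrank_xcell _ _ 1%g) //; apply: twist_left; lra.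
- exact: twist_inj.
rewrite (@seg_class_same_order _ _ (twist i (3 / 4)) u') //; first last.
- by rewrite xu' (@xrank_xcell _ _ (st i)) //; apply: twist_right; lra.
- exact: twist_inj.
by rewrite mul1g mulg1.
Qed.

Definition spread s : config := fun a => ((s a)%:R, a%:R).

Definition ycell : config -> Prop := cell (fun _ _ => False) (fun a b => (a < b)%N).

Lemma convex_ycell : convex_conf ycell.
Proof.
apply: convex_cell => a b; rewrite -val_eqE neq_ltn => /orP[ab|ba].
  by constructor 3.
by constructor 4.
Qed.

Lemma ycell_spread s : ycell (spread s).
Proof. by move=> a b; split=> // ab; rewrite /= ltr_nat. Qed.

Lemma spread_inj s : injective (spread s).
Proof. exact: convex_ycell.1 (ycell_spread s). Qed.

Lemma xcell_spread s : xcell s (spread s).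
Proof. by move=> a b; split=> // ab; rewrite /lexlt /= ltr_nat ab. Qed.

Definition spread_class s : fundamental_group R base := seg_class (spread 1%g) (spread s).

Lemma spread_class1 : spread_class 1%g = 1%g.
Proof. exact: (seg_class1 convex_ycell (ycell_spread _)). Qed.

(** The label is the height, so an ascent says that the lower of the two neighbours is on the left
    and will move to the right. *)
Lemma spread_class_asc s i : asc s i ->
  spread_class (s * st i)%g = (spread_class s * twist_class i)%g.
Proof.
move=> si; rewrite -(@seg_class_swap (spread s) (spread (s * st i)%g) i).
- by rewrite (seg_classM convex_ycell) //; exact: ycell_spread.
- exact: spread_inj.
- exact: spread_inj.
- by rewrite !(xrank_xcell (xcell_spread _)).
- by rewrite (xrank_xcell (xcell_spread _)) /= ltr_nat.
- by rewrite (xrank_xcell (xcell_spread _)) /= ltr_nat.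
Qed.

Lemma asc_st i j : asc (1 * st i)%g j = (st i (lo j) < st i (hi j))%N.
Proof. by rewrite /asc !mulst_inv invg1 !perm1. Qed.

(** Two reduced words of one permutation expand the same [spread_class]; the braid relation arises
    in the same way. *)
Lemma twist_class_comm i j : (i.+1 < j)%N ->
  (twist_class i * twist_class j = twist_class j * twist_class i)%g.
Proof.
move=> ij; have := congr1 spread_class (st_comm ij).
have e (x y : 'S_n.+1) : (x * y = 1 * x * y)%g by rewrite mul1g.
rewrite (e (st i)) (e (st j)).
rewrite !spread_class_asc ?asc1 ?asc_st ?spread_class1 ?mul1g //.
  by rewrite !st_val lo_val hi_val; eq_cases.
by rewrite !st_val lo_val hi_val; eq_cases.
Qed.

Lemma twist_class_braid i j : j = i.+1 :> nat ->
  (twist_class i * twist_class j * twist_class i =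
   twist_class j * twist_class i * twist_class j)%g.
Proof.
move=> ij; have := congr1 spread_class (st_braid ij).
have e (x y z : 'S_n.+1) : (x * y * z = 1 * x * y * z)%g by rewrite mul1g.
rewrite (e (st i)) (e (st j)).
have asc2 i' j' l : asc (1 * st i' * st j')%g l =
    (st i' (st j' (lo l)) < st i' (st j' (hi l)))%N.
  by rewrite /asc !mulst_inv invg1 !perm1.
rewrite !spread_class_asc ?asc2 ?asc_st ?asc1 ?spread_class1 ?mul1g //.
all: by rewrite !st_val lo_val hi_val ij; eq_cases.
Qed.

End half_twists.

(** * Nearby configurations *)

Section nearness.
Context {R : realType} {n : nat}.
Local Notation config := ('I_n.+1 -> R * R).
Local Notation X := (unordered_conf R n.+1).
Implicit Types (p q m : config) (s : 'S_n.+1) (a b : 'I_n.+1) (e E : R).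

Definition near_conf e p q := forall a,
  [/\ (p a).1 - e < (q a).1, (q a).1 < (p a).1 + e,
      (p a).2 - e < (q a).2 & (q a).2 < (p a).2 + e].

Definition spaced E p := forall a b, a != b ->
  [\/ (p a).1 + E <= (p b).1, (p b).1 + E <= (p a).1,
      (p a).2 + E <= (p b).2 | (p b).2 + E <= (p a).2].

Lemma spacedW E E' p : E' <= E -> spaced E p -> spaced E' p.
Proof. by move=> EE sp a b /sp[] h; [constructor 1|constructor 2|constructor 3|constructor 4]; lra. Qed.

Lemma spaced_inj E p : 0 < E -> spaced E p -> injective p.
Proof.
move=> E0 sp a b pab; apply/eqP/negPn/negP => /sp; rewrite pab => -[] h; lra.
Qed.

Lemma finite_choice_radius (I : finType) (P : I -> R -> Prop) :
  (forall i E E', 0 < E' -> E' <= E -> P i E -> P i E') ->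
  (forall i, exists2 E, 0 < E & P i E) -> exists2 E, 0 < E & forall i, P i E.
Proof.
move=> mono PE.
suff H : forall r : seq I, exists2 E, 0 < E & forall i, i \in r -> P i E.
  by have [E E0 HE] := H (enum I); exists E => // i; apply: HE; rewrite mem_enum.
elim=> [|i r [E E0 HE]]; first by exists 1.
have [E' E0' HE'] := PE i; exists (Num.min E E'); first by rewrite lt_min E0.
have m0 : 0 < Num.min E E' by rewrite lt_min E0.
move=> j; rewrite in_cons => /orP[/eqP->|/HE PjE].
  by apply: (mono i E') => //; rewrite ge_min lexx orbT.
by apply: (mono j E) => //; rewrite ge_min lexx.
Qed.

Lemma spaced_exists p : injective p -> exists2 E, 0 < E & spaced E p.
Proof.
move=> pinj; pose P (ab : 'I_n.+1 * 'I_n.+1) E := ab.1 != ab.2 ->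
  [\/ (p ab.1).1 + E <= (p ab.2).1, (p ab.2).1 + E <= (p ab.1).1,
      (p ab.1).2 + E <= (p ab.2).2 | (p ab.2).2 + E <= (p ab.1).2].
have [||E E0 HE] := @finite_choice_radius _ P.
- move=> [a b] E E' _ EE H /H[] /= h;
    [constructor 1|constructor 2|constructor 3|constructor 4] => /=; lra.
- move=> [a b]; rewrite /P /=; have [->|ab] := eqVneq a b; first by exists 1.
  have : p a != p b by rewrite (inj_eq pinj).
  move: (p a) (p b) => [x y] [x' y'] /=; rewrite xpair_eqE negb_and.
  case: (ltgtP x x') => [xx|xx|->] /=; last case: (ltgtP y y') => [yy|yy|//] /= _.
  + by exists (x' - x) => [|_]; [lra|constructor 1; lra].
  + by exists (x - x') => [|_]; [lra|constructor 2; lra].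
  + by exists (y' - y) => [|_]; [lra|constructor 3; lra].
  + by exists (y - y') => [|_]; [lra|constructor 4; lra].
- by exists E => // a b ab; exact: (HE (a, b) ab).
Qed.

Lemma near_conf_refl e p : 0 < e -> near_conf e p p.
Proof. by move=> e0 a; split; lra. Qed.

Lemma near_confW e e' p q : e <= e' -> near_conf e p q -> near_conf e' p q.
Proof. by move=> ee pq a; have [*] := pq a; split; lra. Qed.

Lemma near_conf_pair e p q m : near_conf e p q -> near_conf e p m -> near_conf (2 * e) q m.
Proof. by move=> pq pm a; have [*] := pq a; have [*] := pm a; split; lra. Qed.

Lemma spaced_near e E p q : near_conf e p q -> spaced E p -> spaced (E - 2 * e) q.
Proof.
move=> pq sp a b ab; have [? ? ? ?] := pq a; have [? ? ? ?] := pq b.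
by case: (sp a b ab) => h; [constructor 1|constructor 2|constructor 3|constructor 4]; lra.
Qed.

Lemma convex_near e p : spaced (2 * e) p -> convex_conf (near_conf e p).
Proof.
move=> sp; split=> [q pq a b qab|t q m t0 t1 pq pm a].
  apply/eqP/negPn/negP => ab; have [? ? ? ?] := pq a.
  have := pq b; rewrite -qab {qab} => -[? ? ? ?].
  by case: (sp a b ab) => h; lra.
have [q1 q2 q3 q4] := pq a; have [m1 m2 m3 m4] := pm a.
have low (x u v : R) : x < u -> x < v -> x < u + t * (v - u).
  by move=> xu xv; have := lerp_lt t0 t1 xu xv; lra.
have high (x u v : R) : u < x -> v < x -> u + t * (v - u) < x.
  by move=> xu xv; have := lerp_lt t0 t1 xu xv; lra.
by split; [exact: low|exact: high|exact: low|exact: high].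
Qed.

Lemma lexlt_le (u v : R * R) : lexlt u v -> u.1 <= v.1.
Proof. by move=> /orP[/ltW//|/andP[/eqP-> _]]. Qed.

Lemma lexltN_le (u v : R * R) : lexlt u v = false -> v.1 <= u.1.
Proof. by move/negbT; rewrite negb_or => /andP[]; rewrite -leNgt. Qed.

Lemma ylexlt_le (u v : R * R) : ylexlt u v -> u.2 <= v.2.
Proof. by move/lexlt_le. Qed.

(** If the horizontal order of two points differs between two neighbours of [p], the points are
    nearly aligned vertically in [p]; when [p] is spaced, they are then far apart in height. *)
Lemma lexlt_flip e p q m a b : near_conf e p q -> near_conf e p m ->
  lexlt (q a) (q b) != lexlt (m a) (m b) ->
  (p a).1 < (p b).1 + 2 * e /\ (p b).1 < (p a).1 + 2 * e.
Proof.
move=> pq pm; have [? ? _ _] := pq a; have [? ? _ _] := pq b.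
have [? ? _ _] := pm a; have [? ? _ _] := pm b.
case E1: (lexlt (q a) (q b)); case E2: (lexlt (m a) (m b)) => // _.
  by have := lexlt_le E1; have := lexltN_le E2; lra.
by have := lexltN_le E1; have := lexlt_le E2; lra.
Qed.

Definition close_conf p q := exists e, [/\ 0 < e, spaced (8 * e) p & near_conf e p q].

(** Otherwise two distinct points of [p] would both be near a single point of [q], against the
    spacing. Hence close lifts of two unordered configurations are unique up to a common
    relabelling. *)
Lemma close_unique p q s s' : close_conf p q -> close_conf (relabel p s) (relabel q s') -> s = s'.
Proof.
move=> [e [e0 sp pq]] [e' [e0' sp' pq']]; apply/permP => c.
apply/eqP/negPn/negP => ss.
have [? ? ? ?] := pq (s' c); have := pq' c; rewrite /relabel => -[? ? ? ?].
have := sp _ _ ss.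
have : spaced (8 * e') p.
  move=> a b ab; have := sp' (s^-1 a)%g (s^-1 b)%g; rewrite /relabel !permKV.
  by apply; rewrite (inj_eq perm_inj).
move=> /(_ _ _ ss) [] ? [] ?; lra.
Qed.

Lemma close_inj p q : close_conf p q -> injective p /\ injective q.
Proof.
move=> [e [e0 sp pq]]; split; first by apply: spaced_inj sp; lra.
by apply: spaced_inj (spaced_near pq sp); lra.
Qed.

(** The constant is 18 = 8 * 2 + 2: with [q] as the new centre the radius doubles, and the spacing
    drops by [2 * e]. *)
Lemma close_near e p q m : 0 < e -> spaced (18 * e) p ->
  near_conf e p q -> near_conf e p m -> close_conf q m.
Proof.
move=> e0 sp pq pm; exists (2 * e); split; [lra| |exact: near_conf_pair pq pm].
by apply: spacedW (spaced_near pq sp); lra.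
Qed.

Lemma continuous_conf_point (r : 'I_n.+1) :
  continuous (fun z : ordered_conf R n.+1 => conf_point z r).
Proof.
apply: (continuous_compT (f := fun z : ordered_conf R n.+1 => val z)
  (g := fun f : {ptws 'I_n.+1 -> (R * R)%type} => f r)).
  exact: initial_continuous.
exact: proj_continuous.
Qed.

Lemma near_conf_continuous (T : topologicalType) (f : T -> config) (t0 : T) e p :
  config_continuous f -> near_conf e p (f t0) -> nbhs t0 [set t | near_conf e p (f t)].
Proof.
move=> cf pf; apply: filter_forall => a; have [h1 h2 h3 h4] := pf a.
have c1 : continuous (fun t => (f t a).1) := continuous_compT (cf a) (@continuous_fstT R R).
have c2 : continuous (fun t => (f t a).2) := continuous_compT (cf a) (@continuous_sndT R R).
have gt (u : T -> R) (x : R) : continuous u -> x < u t0 -> nbhs t0 (u @^-1` [set y | x < y]).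
  by move=> cu xu; apply: (cu t0); exact: open_nbhs_nbhs (conj (@open_gt _ _) xu).
have lt (u : T -> R) (x : R) : continuous u -> u t0 < x -> nbhs t0 (u @^-1` [set y | y < x]).
  by move=> cu xu; apply: (cu t0); exact: open_nbhs_nbhs (conj (@open_lt _ _) xu).
near=> t; split; near: t; [exact: gt|exact: lt|exact: gt|exact: lt].
Unshelve. all: by end_near.
Qed.

Definition conf_ball p e : set X := [set x | exists2 q, near_conf e p q & x = to_conf q].

(** In the quotient topology openness is tested upstairs, where the preimage is the union over all
    labellings of an open condition. *)
Lemma nbhs_conf_ball p e : injective p -> 0 < e -> spaced (2 * e) p ->
  nbhs (to_conf p) (conf_ball p e).
Proof.
move=> pinj e0 sp; apply: open_nbhs_nbhs; split; last first.
  by exists p => //; exact: near_conf_refl.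
have -> : open (conf_ball p e) = open (@conf_pi R n.+1 @^-1` conf_ball p e) by [].
have -> : @conf_pi R n.+1 @^-1` conf_ball p e =
    [set z | exists s, near_conf e p (relabel (conf_point z) s)].
  apply/seteqP; split=> -[z zinj] /=; have zinj' : injective z by move: (zinj); rewrite inE.
    have zE : conf_pi (exist _ z zinj) = to_conf z.
      by rewrite (to_confE zinj'); apply/conf_piP; exists 1%g => r; rewrite perm1.
    move=> [q pq]; rewrite zE => /to_conf_eqP => /(_ zinj' ((convex_near sp).1 _ pq))[s qE].
    by exists s; rewrite -[relabel _ _]qE.
  have zE : conf_pi (exist _ z zinj) = to_conf z.
    by rewrite (to_confE zinj'); apply/conf_piP; exists 1%g => r; rewrite perm1.
  by move=> [s pz]; exists (relabel z s) => //; rewrite zE to_conf_relabel.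
rewrite openE => z [s pz].
have /(@near_conf_continuous _ (fun z => relabel (conf_point z) s) z) : config_continuous
    (fun z : ordered_conf R n.+1 => relabel (conf_point z) s).
  by move=> r; exact: continuous_conf_point.
by move=> /(_ e p pz); apply: filterS => z' pz'; exists s.
Qed.

(* The lift of a point of [conf_ball p e] that is near [p]; the junk value [p]
   outside of the ball. *)
Definition ball_lift p e (x : X) : config :=
  if pselect (exists q, near_conf e p q /\ x = to_conf q) is left H then sval (cid H) else p.

Lemma ball_liftP p e x : conf_ball p e x ->
  near_conf e p (ball_lift p e x) /\ to_conf (ball_lift p e x) = x.
Proof.
move=> [q pq xq]; rewrite /ball_lift; case: pselect => [H|[]]; last by exists q.
by case: (cid H) => q' [].
Qed.

Lemma ball_lift_to_conf p e q : 0 < e -> spaced (18 * e) p -> near_conf e p q ->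
  ball_lift p e (to_conf q) = q.
Proof.
move=> e0 sp pq; have [|pl lq] := @ball_liftP p e (to_conf q); first by exists q.
have cq := close_near e0 sp pq pq.
have cl := close_near e0 sp pq pl.
have [qinj linj] := close_inj cl.
have [s ls] := (to_conf_eqP qinj linj).1 (esym lq).
have : close_conf (relabel q 1%g) (relabel q s).
  by rewrite -ls; have -> : relabel q 1%g = q by apply/funext => a; rewrite /relabel perm1.
by move=> /(close_unique cq) s1; rewrite ls -s1; apply/funext => a; rewrite /relabel perm1.
Qed.

(** Over a small ball the quotient map has one sheet near [p], and [ball_lift] is the section into
    it; continuity is checked in a smaller ball around the lifted point. *)
Lemma config_continuous_lift p e (g : R -> X) : 0 < e -> spaced (18 * e) p ->
  continuous g -> (forall t, conf_ball p e (g t)) ->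
  config_continuous (fun t => ball_lift p e (g t)).
Proof.
move=> e0 sp cg gU r t W nW.
have [pl lg] := ball_liftP (gU t); set q := ball_lift p e (g t) in pl lg *.
have [d d0 dW] : exists2 d, 0 < d & forall q', near_conf d q q' -> W (q' r).
  move: nW => /nbhs_ballP[d /= d0 dW]; exists d => // q' qq'; apply: dW.
  by have [*] := qq' r; split=> /=; rewrite /ball /= ltr_distl; apply/andP; split; lra.
have [d' d0' dp] : exists2 d', 0 < d' & forall q', near_conf d' q q' -> near_conf e p q'.
  pose P a d := [/\ (p a).1 - e + d <= (q a).1, (q a).1 + d <= (p a).1 + e,
     (p a).2 - e + d <= (q a).2 & (q a).2 + d <= (p a).2 + e].
  have [||d' d0' H] := @finite_choice_radius _ P.
  - by move=> a E E' _ EE [*]; split; lra.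
  - move=> a; have [h1 h2 h3 h4] := pl a.
    pose m1 := Num.min ((q a).1 - ((p a).1 - e)) ((p a).1 + e - (q a).1).
    pose m2 := Num.min ((q a).2 - ((p a).2 - e)) ((p a).2 + e - (q a).2).
    have m0 : 0 < Num.min m1 m2 by rewrite !lt_min !subr_gt0 h1 h2 h3 h4.
    exists (Num.min m1 m2) => //; move: m0; set m := Num.min m1 m2 => m0.
    have : m <= m1 by rewrite ge_min lexx.
    have : m <= m2 by rewrite ge_min lexx orbT.
    by rewrite !le_min => /andP[? ?] /andP[? ?]; split; lra.
  - exists d' => // q' qq' a; have [*] := H a; have [*] := qq' a; split; lra.
(* The bound [d] puts nearby lifts in [W], the bound [d'] keeps them on the sheet near [p], and the
   bound [e] ensures the spacing of [q]. *)
pose c := Num.min e (Num.min d d').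
have c0 : 0 < c by rewrite !lt_min e0 d0 d0'.
have ce : c <= e by rewrite ge_min lexx.
have qinj : injective q by apply: spaced_inj (spaced_near pl sp); lra.
have : nbhs (g t) (conf_ball q c).
  rewrite -lg; apply: nbhs_conf_ball => //.
  by apply: spacedW (spaced_near pl sp); lra.
move=> nU; have {nU} : nbhs t (g @^-1` conf_ball q c) by exact: cg.
apply: filterS => t' [q' qq' gq'].
rewrite /= gq' ball_lift_to_conf //.
  by apply: dW; apply: near_confW qq'; rewrite /c !ge_min lexx orbT.
by apply: dp; apply: near_confW qq'; rewrite /c !ge_min lexx !orbT.
Qed.

End nearness.

(** * The isomorphism *)

Section crossings.
Context {R : realType} {n : nat}.
Local Notation config := ('I_n.+1 -> R * R).
Local Notation X := (unordered_conf R n.+1).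
Local Notation base := (base_conf R n.+1).
Implicit Types (p q m : config) (s : 'S_n.+1) (a b : 'I_n.+1) (e : R) (i j : 'I_n).

Lemma braid_gen_mul i j : (@braid_gen n.+1 i * @braid_gen n.+1 j)%g =
  pg_pi (@braid_rel n.+1) [:: (i, false); (j, false)].
Proof. exact: pg_mulE. Qed.

Lemma braid_gen_braid i j : j = i.+1 :> nat ->
  (@braid_gen n.+1 i * @braid_gen n.+1 j * @braid_gen n.+1 i =
   @braid_gen n.+1 j * @braid_gen n.+1 i * @braid_gen n.+1 j)%g.
Proof.
move=> ij; rewrite !braid_gen_mul.
apply: etrans (pg_mulE _ [:: _; _] [:: _]) (etrans _ (esym (pg_mulE _ [:: _; _] [:: _]))).
by apply/pg_piP/word_eq_rel; exact: braid_rel_braid.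
Qed.

Lemma braid_gen_comm i j : (i.+1 < j)%N ->
  (@braid_gen n.+1 i * @braid_gen n.+1 j = @braid_gen n.+1 j * @braid_gen n.+1 i)%g.
Proof.
move=> ij; rewrite !braid_gen_mul; apply/pg_piP/word_eq_rel.
apply: braid_rel_comm; have far (x y : nat) : (x.+1 < y)%N -> 1 < `|x%:Z - y%:Z| by lia.
exact: far.
Qed.

Definition braid_lift s : braid_group n.+1 :=
  positive_lift (fun i : 'I_n => @braid_gen n.+1 i) s.

Lemma twist_class_rels (u v : word 'I_n) : @braid_rel n.+1 u v ->
  eval_word (@twist_class R n) u = eval_word (@twist_class R n) v.
Proof.
case=> {u v} [i j ij|i j ij]; rewrite /= !mulg1 ?mulgA; first exact: twist_class_braid.
have far (x y : nat) : 1 < `|x%:Z - y%:Z| -> (x.+1 < y)%N \/ (y.+1 < x)%N by lia.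
by case: (far _ _ ij) => h; [|apply/esym]; exact: twist_class_comm.
Qed.

Definition braid_hom : {multiplicative braid_group n.+1 -> fundamental_group R base} :=
  presented_morphism twist_class_rels.

Lemma braid_hom_gen i : braid_hom (@braid_gen n.+1 i) = twist_class i.
Proof. exact: presented_hom_gen twist_class_rels i. Qed.

Lemma braid_hom_lift s : braid_hom (braid_lift s) = spread_class s.
Proof.
move: s; apply: asc_ind => [|s i si IH].
  by rewrite /braid_lift positive_lift1 multiplicative1 spread_class1.
rewrite /braid_lift positive_lift_asc //.
- by rewrite gmulfM IH braid_hom_gen spread_class_asc.
- exact: braid_gen_braid.
- exact: braid_gen_comm.
Qed.

Definition crossing p q : braid_group n.+1 :=
  ((braid_lift ((yrank p)^-1 * xrank p))^-1 * braid_lift ((yrank p)^-1 * xrank q))%g.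

Lemma crossing_relabel p q s : injective p -> injective q ->
  crossing (relabel p s) (relabel q s) = crossing p q.
Proof.
move=> pinj qinj; rewrite /crossing !xrank_relabel // yrank_relabel //.
by rewrite invgM -!mulgA !(mulKg s).
Qed.

(** Moving the reference heights from [q] to the fixed centre [p] turns the crossings of a ball into
    a coboundary. A pair whose height order differs in [p] and [q] is close vertically, hence far
    apart horizontally, as [positive_lift_height] requires. *)
Lemma crossing_ball e p q m : 0 < e -> spaced (8 * e) p ->
  near_conf e p q -> near_conf e p m ->
  crossing q m = ((braid_lift ((yrank p)^-1 * xrank q))^-1 *
                  braid_lift ((yrank p)^-1 * xrank m))%g.
Proof.
move=> e0 sp pq pm.
have pinj : injective p by apply: spaced_inj sp; lra.
have inj l : near_conf e p l -> injective l.
  by move=> pl; apply: spaced_inj (spaced_near pl sp); lra.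
have [qinj minj] := (inj q pq, inj m pm).
pose t := ((yrank p)^-1 * yrank q)%g.
have tE u : ((yrank q)^-1 * u = t^-1 * ((yrank p)^-1 * u))%g.
  by rewrite /t invgM invgK -mulgA mulVKg.
rewrite /crossing !tE; apply: positive_lift_height.
- exact: braid_gen_braid.
- exact: braid_gen_comm.
move=> h h' hh'; rewrite /t !permM.
set a := ((yrank p)^-1 h)%g; set b := ((yrank p)^-1 h')%g => yba.
have yab : (yrank p a < yrank p b)%N by rewrite !permKV.
have ab : a != b by apply: contraTneq yab => ->; rewrite ltnn.
move: yba yab; rewrite (yrankP _ _ qinj) (yrankP _ _ pinj) (xrankP _ _ qinj) (xrankP _ _ minj) => /ylexlt_le yba /ylexlt_le yab.
apply/eqP/negPn/negP => /(lexlt_flip pq pm)[x1 x2].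
have [_ _ ? ?] := pq a; have [_ _ ? ?] := pq b.
by case: (sp a b ab) => ?; lra.
Qed.

(** The segment is compared with one between model configurations [w], placed at horizontal rank in
    [q] or [m] and at vertical rank in [q]. These are relabelled [spread] configurations, whose
    segments are images of positive lifts. *)
Lemma seg_class_ball e p q m : 0 < e -> spaced (8 * e) p ->
  near_conf e p q -> near_conf e p m ->
  seg_class q m = braid_hom (crossing q m).
Proof.
move=> e0 sp pq pm.
have inj l : near_conf e p l -> injective l.
  by move=> pl; apply: spaced_inj (spaced_near pl sp); lra.
have [qinj minj] := (inj q pq, inj m pm).
(* Pairs in the same horizontal order at both ends are separated by it, the exchanged ones by the
   height order of [q]; [m] shares that order, since exchanged points are far apart in height. *)
pose xo a b := (xrank q a < xrank q b)%N /\ (xrank m a < xrank m b)%N.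
pose yo a b := (xrank q a < xrank q b)%N != (xrank m a < xrank m b)%N /\
  (yrank q a < yrank q b)%N.
have cD : convex_conf (@cell R n xo yo).
  apply: convex_cell => a b ab.
  have tot s : (s b < s a)%N = ~~ (s a < s b)%N.
    by rewrite -leqNgt [RHS]leq_eqVlt val_eqE (inj_eq perm_inj) eq_sym (negbTE ab).
  rewrite /xo /yo (tot (xrank q)) (tot (xrank m)) (tot (yrank q)).
  case: (xrank q a < xrank q b)%N; case: (xrank m a < xrank m b)%N;
    case: (yrank q a < yrank q b)%N;
    by [constructor 1|constructor 2|constructor 3|constructor 4].
have yoP a b : yo a b -> (q a).2 < (q b).2 /\ (m a).2 < (m b).2.
  rewrite /yo (xrankP _ _ qinj) (xrankP _ _ minj) (yrankP _ _ qinj) => -[/(lexlt_flip pq pm)[x1 x2] yab].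
  have ab : a != b by apply: contraTneq yab => ->; rewrite /ylexlt lexlt_irr.
  have {}yab := ylexlt_le yab.
  have [_ _ ? ?] := pq a; have [_ _ ? ?] := pq b.
  have [_ _ ? ?] := pm a; have [_ _ ? ?] := pm b.
  by case: (sp a b ab) => ?; lra.
have Dq : cell xo yo q by move=> a b; split=> [[h _]|/yoP[]//]; rewrite -xrankP.
have Dm : cell xo yo m by move=> a b; split=> [[_ h]|/yoP[]//]; rewrite -xrankP.
pose w s := relabel (@spread R n ((yrank q)^-1 * s)%g) (yrank q).
have wE s a : w s a = ((s a)%:R, (yrank q a)%:R) by rewrite /w /relabel /spread permM permK.
have wx s : xcell s (w s).
  by move=> a b; split=> // ab; rewrite !wE /lexlt /= ltr_nat ab.
have winj s : injective (w s) := (convex_xcell s).1 _ (wx s).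
have Dwq : cell xo yo (w (xrank q)).
  move=> a b; split=> [[h _]|[_ h]]; last by rewrite !wE ltr_nat.
  exact: (wx _ a b).1.
have Dwm : cell xo yo (w (xrank m)).
  move=> a b; split=> [[_ h]|[_ h]]; last by rewrite !wE ltr_nat.
  exact: (wx _ a b).1.
rewrite -(seg_classM cD Dq Dwq Dm) -(seg_classM cD Dwq Dwm Dm).
rewrite seg_class_same_order ?(xrank_xcell (wx _)) // mul1g.
rewrite (@seg_class_same_order _ _ (w (xrank m))) ?(xrank_xcell (wx _)) // mulg1.
rewrite (seg_class_relabel _ convex_ycell (ycell_spread _) (ycell_spread _)).
rewrite /crossing gmulfM multiplicativeV !braid_hom_lift /spread_class.
rewrite -(seg_classV convex_ycell (ycell_spread _) (ycell_spread _)).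
by rewrite (seg_classM convex_ycell (ycell_spread _) (ycell_spread _) (ycell_spread _)).
Qed.

(* The junk value [1] is taken when no lifts of the two points are close. *)
Definition conf_cocycle (x y : X) : braid_group n.+1 :=
  if pselect (exists pq : config * config,
    [/\ close_conf pq.1 pq.2, to_conf pq.1 = x & to_conf pq.2 = y]) is left H
  then crossing (sval (cid H)).1 (sval (cid H)).2 else 1%g.

Lemma conf_cocycleE p q : close_conf p q ->
  conf_cocycle (to_conf p) (to_conf q) = crossing p q.
Proof.
move=> pq; rewrite /conf_cocycle; case: pselect => [H|[]]; last by exists (p, q).
case: (cid H) => -[p' q'] /= [pq' pp qq].
have [[pinj qinj] [pinj' qinj']] := (close_inj pq, close_inj pq').
have [s ps] := (to_conf_eqP pinj pinj').1 (esym pp).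
have [s' qs] := (to_conf_eqP qinj qinj').1 (esym qq).
rewrite ps qs in pq' *; rewrite -(close_unique pq pq').
exact: crossing_relabel.
Qed.

Lemma trivializing_conf_ball e p : 0 < e -> spaced (18 * e) p ->
  trivializing conf_cocycle (conf_ball p e).
Proof.
move=> e0 sp.
exists (fun x => braid_lift ((yrank p)^-1 * xrank (ball_lift p e x))%g) => x y.
move=> /ball_liftP[px xE] /ball_liftP[py yE].
rewrite -[in LHS]xE -[in LHS]yE conf_cocycleE; last exact: close_near px py.
by apply: crossing_ball px py => //; apply: spacedW sp; lra.
Qed.

Lemma conf_ball_exists (x : X) : exists p e,
  [/\ 0 < e, spaced (18 * e) p & nbhs x (conf_ball p e)].
Proof.
have [p pinj <-] := to_conf_surj x; have [E E0 sp] := spaced_exists pinj.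
exists p, (E / 18); split; first by rewrite divr_gt0.
  by apply: spacedW sp; lra.
by apply: nbhs_conf_ball => //; [rewrite divr_gt0|apply: spacedW sp; lra].
Qed.

Lemma conf_locally_trivial (x : X) : exists2 U : set X, nbhs x U & trivializing conf_cocycle U.
Proof.
have [p [e [e0 sp nx]]] := conf_ball_exists x.
by exists (conf_ball p e) => //; exact: trivializing_conf_ball.
Qed.

Lemma continuous_loop (l : loop R base) : continuous (fun t : R => l (clampI t)).
Proof.
apply: (continuous_compT (g := l)); first exact: continuous_clampI.
exact: cts_fun.
Qed.

(** A representative loop is chosen here; [braid_monodromyE] removes the choice by homotopy
    invariance. *)
Definition braid_monodromy (x : fundamental_group R base) : braid_group n.+1 :=
  sval (cid (holonomy_exists conf_locally_trivial (@continuous_loop (repr x)))).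

Lemma braid_monodromyE (l : loop R base) g :
  holonomy conf_cocycle (fun t => l (clampI t)) g -> braid_monodromy (loop_class l) = g.
Proof.
rewrite /braid_monodromy; case: cid => g' /= hg' hg.
have /loop_classP [H [cH H0 H1 Hl Hr]] : loop_class (repr (loop_class l)) = loop_class l.
  exact: loop_classK.
apply: (holonomy_homotopic conf_locally_trivial) hg' hg.
apply: (@path_homotopicI _ _ _ _ (fun z => H (clampI z.1, clampI z.2))) => [|t _ _|t _ _|s _ _|s _ _] /=.
- apply: (continuous_compT (g := H)) => //; apply: continuous_pairT.
    exact: (continuous_compT (@continuous_fstT R R) (@continuous_clampI R)).
  exact: (continuous_compT (@continuous_sndT R R) (@continuous_clampI R)).
- exact: H0.
- exact: H1.
- by rewrite Hl path_zero.
- by rewrite Hr path_one.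
Qed.

Lemma braid_monodromyM : {morph braid_monodromy : x y / (x * y)%g}.
Proof.
move=> x y; rewrite -[x]loop_classK -[y]loop_classK.
have hx := holonomy_exists conf_locally_trivial (@continuous_loop (repr x)).
have hy := holonomy_exists conf_locally_trivial (@continuous_loop (repr y)).
case: hx hy => [u hu] [v hv].
rewrite (braid_monodromyE hu) (braid_monodromyE hv).
have -> : (loop_class (repr x) * loop_class (repr y))%g =
    loop_class (loop_mul (repr x) (repr y)) by exact: loop_classM.
apply: braid_monodromyE.
have e : repr x (clampI (1 : R)) = repr y (clampI (0 : R)).
  by rewrite path_one path_zero.
have := holonomy_concat conf_locally_trivial (@continuous_loop _) (@continuous_loop _) e hu hv.
have [w hw] := holonomy_exists conf_locally_trivial (@continuous_loop (loop_mul (repr x) (repr y))).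
move=> huv; rewrite (_ : (u * v)%g = w) //.
apply: (holonomy_ext conf_locally_trivial _ _ huv hw).
  by apply: continuous_cat e; exact: continuous_loop.
by move=> t t0 t1; rewrite loop_mulE clampIE.
Qed.

HB.instance Definition _ := isMultiplicative.Build
  (fundamental_group R base) (braid_group n.+1) braid_monodromy braid_monodromyM.

Lemma holonomy_twist i :
  holonomy conf_cocycle (fun t => to_conf (@twist R n i t)) (@braid_gen n.+1 i).
Proof.
have cf : continuous (fun t => to_conf (@twist R n i t)).
  apply: continuous_to_conf; [exact: config_continuous_twist|exact: twist_inj].
(* The jump comes after time 1/2, in accordance with the way ties are broken at the midpoint. *)
pose F (t : R) : braid_group n.+1 := if t <= 1 / 2 then 1%g else @braid_gen n.+1 i.
exists F; split; last first.
  rewrite /F ifT; last lra.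
  rewrite ifF; last by apply/negbTE; rewrite -ltNge; lra.
  by rewrite invg1 mul1g.
apply: (local_development cf) => u u0 u1.
have [E E0 sp] := spaced_exists (@twist_inj R n i u).
pose e := E / 18; have e0 : 0 < e by rewrite divr_gt0.
have /nbhs_ballP[r /= r0 near_u] : nbhs u [set t | near_conf e (twist i u) (twist i t)].
  apply: near_conf_continuous; first exact: config_continuous_twist.
  exact: near_conf_refl.
(* The bound 1/4 forces [0 < c] when [c] and [d] lie on different sides of 1/2, so the exchanged
   points have distinct heights at time [c]. *)
exists (Num.min r (1 / 4)); first by rewrite lt_min r0 /=; lra.
move=> c d c0 cd d1; rewrite !lt_min => /andP[cr c4] /andP[dr d4].
have nc : near_conf e (twist i u) (twist i c) by apply: near_u; rewrite /ball /= distrC.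
have nd : near_conf e (twist i u) (twist i d) by apply: near_u; rewrite /ball /= distrC.
rewrite conf_cocycleE; last first.
  by apply: close_near nc nd => //; apply: spacedW sp; rewrite /e; lra.
have left_order t : 0 <= t -> t <= 1 / 2 -> xrank (@twist R n i t) = 1%g.
  by move=> t0 t2; apply: xrank_xcell; exact: twist_left.
have right_order t : 1 / 2 < t -> t <= 1 -> xrank (@twist R n i t) = st i.
  by move=> t2 t1; apply: xrank_xcell; exact: twist_right.
have cinj := @twist_inj R n i c.
rewrite /crossing /F; have [c2|c2] := leP c (1 / 2); have [d2|d2] := leP d (1 / 2).
- by rewrite !left_order ?mulVg //; lra.
- rewrite left_order // (right_order d) //.
  rewrite mulg1 /braid_lift positive_lift_asc ?mulKg ?invg1 ?mul1g //.
  + exact: braid_gen_braid.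
  + exact: braid_gen_comm.
  + rewrite /asc invgK yrankP //.
    have c0' : 0 < c by move: c4 d4; rewrite !ltr_norml => /andP[? ?] /andP[? ?]; lra.
    rewrite /ylexlt /lexlt /=; apply/orP; left.
    have c1 : c < 1 by lra.
    by have [_] := @twist_middle R n i c c0' c1 (lo i) (hi i); apply.
- by exfalso; lra.
- by rewrite !right_order ?mulVg //; lra.
Qed.

Lemma braid_monodromy_twist i : braid_monodromy (twist_class i) = @braid_gen n.+1 i.
Proof.
apply: braid_monodromyE.
have [g hg] := holonomy_exists conf_locally_trivial (@continuous_loop (@half_twist_loop R n.+1 i)).
rewrite (_ : @braid_gen n.+1 i = g) //.
apply: (holonomy_ext conf_locally_trivial _ _ (holonomy_twist i) hg).
  apply: continuous_to_conf; [exact: config_continuous_twist|exact: twist_inj].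
move=> t t0 t1; rewrite [LHS](to_confE (@half_twist_points_inj R n.+1 i (pi * t))).
by rewrite -[RHS]/(@half_twist_fun R n.+1 i (clampI t)) /half_twist_fun clampIE.
Qed.

Lemma braid_homK : cancel braid_hom braid_monodromy.
Proof.
pose f := [the {multiplicative braid_group n.+1 -> braid_group n.+1} of
  braid_monodromy \o braid_hom].
pose g := [the {multiplicative braid_group n.+1 -> braid_group n.+1} of idfun].
move=> x; apply: (@presented_group_hom_ext _ _ (braid_group n.+1) f g) => i /=.
by rewrite [X in braid_monodromy X](braid_hom_gen i) braid_monodromy_twist.
Qed.

Lemma braid_hom_surj (x : fundamental_group R base) : exists g, braid_hom g = x.
Proof.
rewrite -[x]loop_classK; set l := repr x; pose f (t : R) := l (clampI t).
have cf : continuous f := @continuous_loop l.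
pose P (a b : R) := exists g, braid_hom g = conf_class (subpath cf a b).
have [g gE] : P 0 1.
  apply: (@interval_induction R P); first exact: ler01.
    move=> c d e _ _ _ _ [g gE] [h hE]; exists (g * h)%g.
    rewrite gmulfM gE hE -closed_classM; apply: closed_class_eq.
    exact: subpath_cat.
  move=> u u0 u1; have [p [e [e0 sp nU]]] := conf_ball_exists (f u).
  have [r r0 rU] := nearR cf nU.
  exists r => // c d c0 cd d1 cr dr.
  (* The parameter is clamped because the continuity lemma for lifts asks that the path stay in the
     ball at all real times. *)
  pose v (t : R) := c + (d - c) * cl t.
  have vU t : conf_ball p e (f (v t)).
    apply: rU; have [? ?] := (cl_ge0 t, cl_le1 t).
    by apply: norm_between cr dr; rewrite /v; nra.
  have cv : continuous v.
    apply: continuous_addT; first exact: continuous_cstT.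
    by apply: continuous_mulT; [exact: continuous_cstT|exact: continuous_cl].
  have sp2 : spaced (2 * e) p by apply: spacedW sp; lra.
  have sp8 : spaced (8 * e) p by apply: spacedW sp; lra.
  have pl t : near_conf e p (ball_lift p e (f (v t))) by exact: (ball_liftP (vU t)).1.
  exists (crossing (ball_lift p e (f (v 0))) (ball_lift p e (f (v 1)))).
  rewrite -(seg_class_ball e0 sp8 (pl 0) (pl 1)); apply/esym.
  apply: (@conf_class_seg _ _ _ (fun t => ball_lift p e (f (v t)))) (convex_near sp2) _ _ _.
  - by apply: config_continuous_lift vU => //; exact: (continuous_compT cv cf).
  - by move=> t _ _; exact: pl.
  - by move=> t t0 t1; rewrite (ball_liftP (vU t)).2 subpathE /v cl_id.
exists g; rewrite gE.
have f0 : f 0 = base by exact: (@path_zero _ _ _ _ l).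
have f1 : f 1 = base by exact: (@path_one _ _ _ _ l).
pose q := PathFromTo cf f0 f1.
have -> : conf_class (subpath cf 0 1) = conf_class q.
  by apply: closed_class_ext => t _ _ /=; rewrite subr0 mul1r add0r.
by apply: closed_class_loop => // t; exact: connection_base.
Qed.

End crossings.

Theorem theorem2p4p6 (R : realType) (k : nat) (hk : (1 <= k)%N) :
  exists phi :
      {multiplicative braid_group k -> fundamental_group R (base_conf R k)},
    (forall i : 'I_k.-1,
        phi (braid_gen i) = loop_class (half_twist_loop R i)) /\
    bijective phi.
Proof.
case: k hk => // n _; exists braid_hom; split; first exact: braid_hom_gen.
exists braid_monodromy; first exact: braid_homK.
by move=> x; have [g <-] := braid_hom_surj x; rewrite braid_homK.
Qed.
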